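(* Let $k$ be a field of prime characteristic $p$ and let $G$ be a net-free generalized caterpillar graph on the vertex set $[n]=\{1,\dots,n\}$, with binomial edge ideal $J_G\subseteq S=k[x_1,\dots,x_n,y_1,\dots,y_n]$. Let $\mathscr R^s(J_G)=\bigoplus_{m\ge0}J_G^{(m)}t^m\subseteq S[t]$ be the symbolic Rees algebra of $J_G$, and assume that for $R=\mathscr R^s(J_G)$ and every power $q$ of $p$ the $R$-module $R^{1/q}$ is finitely generated. Then $\mathscr R^s(J_G)$ is strongly $F$-regular.
   Context: All graphs are finite and simple. Clique join via an edge: for a graph $H$, an edge $e=\{w_1,w_2\}\in E(H)$ and $t\ge 3$, the clique join of $K_t$ on $H$ via $e$ is obtained from $H$ by adding $t-2$ new vertices $u_1,\dots,u_{t-2}$, all edges $\{u_i,w_j\}$ for $1\le i\le t-2$, $j=1,2$, and all edges $\{u_i,u_j\}$, $i<j$. Adding a whisker to $H$ at a vertex $v$ means adding one new vertex $u$ and the edge $\{u,v\}$. Generalized caterpillar graph: a graph obtained from a path $P$ by performing in succession clique joins of some complete graphs $K_{t_1},\dots,K_{t_m}$ via pairwise distinct edges $e_1,\dots,e_m$ of $P$ and finally, possibly, adding a finite number of whiskers to the vertices (of the graph obtained after the clique joins). Net: the graph on six vertices consisting of a triangle with exactly one whisker attached at each of its three vertices. A graph is net-free if it has no induced subgraph isomorphic to the net. Binomial edge ideal: for a graph $G$ on $[n]$, $J_G$ is the ideal of $S$ generated by the binomials $f_{i,j}=x_iy_j-y_ix_j$ with $\{i,j\}\in E(G)$. Symbolic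 power: if $I$ is an ideal of a Noetherian ring with minimal primes $\mathfrak p_1,\dots,\mathfrak p_r$, then $I^{(m)}=\mathfrak q_1\cap\dots\cap\mathfrak q_r$, where $\mathfrak q_i$ is the $\mathfrak p_i$-primary component of $I^m$; $I^{(0)}$ is the whole ring. Strongly $F$-regular: let $R$ be a reduced Noetherian domain of prime characteristic $p$ and, for $q$ a power of $p$, let $R^{1/q}$ be the ring obtained by adjoining all $q$-th roots of elements of $R$, regarded as an $R$-module in the natural way; suppose $R^{1/q}$ is a finitely generated $R$-module. Let $R^0$ be the complement of the union of the minimal primes of $R$. Then $R$ is strongly $F$-regular if for every $c\in R^0$ there is $e\in\mathbb N$ such that the $R$-module homomorphism $R\to R^{1/p^e}$ sending $1$ to $c^{1/p^e}$ splits as a homomorphism of $R$-modules. *)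

(* Defs.v *)
From HB Require Import structures.
From mathcomp Require Import all_boot all_order all_algebra.
From mathcomp Require Import boolp.
From mathcomp Require Import mpoly.

Set Implicit Arguments.
Unset Strict Implicit.
Unset Printing Implicit Defensive.

Import GRing.Theory.
Local Open Scope ring_scope.

Section Ideals.
Variable R : comNzRingType.
Implicit Types (I J P q A : R -> Prop).

Record ideal I : Prop := Ideal {
  ideal0 : I 0;
  idealD : forall x y, I x -> I y -> I (x + y);
  idealM : forall a x, I x -> I (a * x) }.

Definition ideal_gen A : R -> Prop :=
  fun x => forall I, ideal I -> (forall a, A a -> I a) -> I x.

Definition ideal_mul I J : R -> Prop :=
  ideal_gen (fun z => exists x y, [/\ I x, J y & z = x * y]).

Fixpoint ideal_exp I (m : nat) : R -> Prop :=
  if m is m'.+1 then ideal_mul I (ideal_exp I m') else fun=> True.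

Definition noetherian : Prop :=
  forall I, ideal I -> exists s : seq R,
    forall x, I x <-> ideal_gen (fun a => a \in s) x.

Definition radical I : R -> Prop := fun x => exists n : nat, I (x ^+ n).

Definition prime_ideal P : Prop :=
  [/\ ideal P, ~ P 1 & forall x y, P (x * y) -> P x \/ P y].

Definition primary_ideal q : Prop :=
  [/\ ideal q, ~ q 1 & forall x y, q (x * y) -> q x \/ radical q y].

Definition minimal_prime J P : Prop :=
  [/\ prime_ideal P, forall x, J x -> P x &
      forall P', prime_ideal P' -> (forall x, J x -> P' x) ->
        (forall x, P' x -> P x) -> forall x, P x -> P' x].

Definition primary_decomposition J (T : finType) (q : T -> R -> Prop) : Prop :=
  (forall i, primary_ideal (q i)) /\ (forall x, J x <-> forall i, q i x).

Definition minimal_primary_decomposition J (T : finType) (q : T -> R -> Prop) :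
    Prop :=
  [/\ primary_decomposition J q,
      forall i j, (forall x, radical (q i) x <-> radical (q j) x) -> i = j &
      forall i, exists2 x, forall j, j != i -> q j x & ~ q i x].

Definition primary_component J P q : Prop :=
  exists (T : finType) (Q : T -> R -> Prop),
    minimal_primary_decomposition J Q /\
    exists i, (forall x, Q i x <-> q x) /\ (forall x, radical (Q i) x <-> P x).

(* For [P] minimal over [I] and [R] noetherian, the [P]-primary component of
   [I ^ m] exists and is unique ([primary_component_exists],
   [primary_componentE]), so that the quantification over [q] is harmless. *)
Definition symbolic_power I (m : nat) : R -> Prop :=
  if m is 0 then fun=> True else
  fun x => forall P, minimal_prime I P ->
           forall q, primary_component (ideal_exp I m) P q -> q x.

Lemma ideal_genP A : ideal (ideal_gen A).
Proof.
split=> [I iI _|x y hx hy I iI hA|a x hx I iI hA].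
- exact: ideal0.
- by apply: idealD => //; [apply: hx|apply: hy].
- by apply: idealM => //; apply: hx.
Qed.

Lemma ideal_gen_sub A x : A x -> ideal_gen A x.
Proof. by move=> Ax I _; apply. Qed.

Lemma idealMr I a x : ideal I -> I x -> I (x * a).
Proof. by move=> iI Ix; rewrite mulrC; apply: idealM. Qed.

Lemma idealN I x : ideal I -> I x -> I (- x).
Proof. by move=> iI Ix; rewrite -mulN1r; apply: idealM. Qed.

Lemma idealB I x y : ideal I -> I x -> I y -> I (x - y).
Proof. by move=> iI Ix Iy; apply: idealD => //; apply: idealN. Qed.

Lemma ideal_expP I m : ideal (ideal_exp I m).
Proof. by case: m => [|m] /=; [split|apply: ideal_genP]. Qed.

Lemma ideal_exp_mul I a b x y :
  ideal_exp I a x -> ideal_exp I b y -> ideal_exp I (a + b) (x * y).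
Proof.
elim: a x => [|a IH] x hx hy; first by rewrite add0n; apply: (idealM (ideal_expP _ _)).
have iE := ideal_expP I (a.+1 + b).
apply: (hx (fun x => ideal_exp I (a.+1 + b) (x * y))).
  split=> [|u v hu hv|c u hu].
  - by rewrite mul0r; apply: (ideal0 iE).
  - by rewrite mulrDl; apply: (idealD iE).
  - by rewrite -mulrA; apply: (idealM iE).
move=> _ [u [v [hu hv ->]]].
rewrite -mulrA addSn /=; apply: ideal_gen_sub; exists u, (v * y).
by split=> //; apply: IH.
Qed.

Lemma ideal_exp_pow I m x : I x -> ideal_exp I m (x ^+ m).
Proof.
move=> Ix; elim: m => [|m IH] //=; rewrite exprS.
by apply: ideal_gen_sub; exists x, (x ^+ m).
Qed.

Lemma prime_pow P x n : prime_ideal P -> P (x ^+ n) -> P x.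
Proof.
case=> iP P1 PM; elim: n => [|n IH]; first by rewrite expr0 => /P1.
by rewrite exprS => /PM [].
Qed.

Lemma ideal_exp_sub I m x : ideal I -> ideal_exp I m.+1 x -> I x.
Proof.
move=> iI; apply=> // _ [u [v [hu _ ->]]]; exact: idealMr.
Qed.

Lemma prime_ideal_exp I P m : prime_ideal P ->
  (forall x, ideal_exp I m x -> P x) -> forall x, I x -> P x.
Proof.
by move=> pP h x Ix; apply: (prime_pow (n := m)) => //; apply: h; apply: ideal_exp_pow.
Qed.

Lemma prime_prod P (T : finType) (s : T -> R) (A : pred T) : prime_ideal P ->
  (forall i, A i -> ~ P (s i)) -> ~ P (\prod_(i | A i) s i).
Proof.
move=> [_ P1 PM] h; apply: (big_ind (fun z => ~ P z)) => //.
by move=> x y hx hy /PM [].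
Qed.

Lemma radical_ideal I : ideal I -> ideal (radical I).
Proof.
move=> iI; split=> [|x y [a ha] [b hb]|c x [a ha]].
- by exists 1%N; rewrite expr1; apply: ideal0.
- exists (a + b)%N; rewrite exprDn.
  apply: (big_ind I); [exact: ideal0|exact: idealD|] => i _.
  have idM u z : I z -> I (z *+ u).
    by move=> hz; rewrite -mulr_natl; apply: idealM.
  apply: idM; have [le_ai|lt_ia] := leqP b i.
    by rewrite -(subnK le_ai) [y ^+ _]exprD mulrA; apply: idealM.
  have le_a : (a <= a + b - i)%N by rewrite -addnBA ?leq_addr // ltnW.
  by rewrite -(subnK le_a) [x ^+ _]exprD mulrAC; apply: idealM.
- by exists a; rewrite exprMn; apply: idealM.
Qed.

Lemma radical_prime q : primary_ideal q -> prime_ideal (radical q).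
Proof.
case=> iq q1 qM; split; first exact: radical_ideal.
  by case=> n; rewrite expr1n.
move=> x y [n]; rewrite exprMn => /qM [h|[m h]]; first by left; exists n.
by right; exists (n * m)%N; rewrite exprM.
Qed.

Lemma radical_sub q P : prime_ideal P -> (forall x, q x -> P x) ->
  forall x, radical q x -> P x.
Proof. by move=> pP h x [n /h]; apply: prime_pow. Qed.

Lemma not_forall_sub I J :
  ~ (forall x, I x -> J x) -> exists2 x, I x & ~ J x.
Proof. by move=> /existsNP[x /not_implyP[? ?]]; exists x. Qed.

Section NoetherianInduction.
Hypothesis noethR : noetherian.

Lemma noetherian_chain (J : nat -> R -> Prop) :
  (forall n, ideal (J n)) -> (forall n x, J n x -> J n.+1 x) ->
  exists n, forall m x, J m x -> J n x.
Proof.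
move=> iJ incJ.
have le_J m n x : (m <= n)%N -> J m x -> J n x.
  by move=> /subnK <-; elim: (n - m)%N => //= d IH /IH; apply: incJ.
have iU : ideal (fun x => exists n, J n x).
  split=> [|x y [a ha] [b hb]|c x [a ha]].
  - by exists 0%N; apply: ideal0.
  - exists (maxn a b); apply: idealD => //.
      exact: le_J (leq_maxl _ _) ha.
    exact: le_J (leq_maxr _ _) hb.
  - by exists a; apply: idealM.
have [s hs] := noethR iU.
have [n hn] : exists n, forall a, a \in s -> J n a.
  have : forall a, a \in s -> exists n, J n a.
    by move=> a sa; apply/hs; apply: ideal_gen_sub.
  elim: (s) => [|a t IH] h; first by exists 0%N.
  have [m hm] : exists m, forall b, b \in t -> J m b.
    by apply: IH => b tb; apply: h; rewrite inE tb orbT.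
  have [l hl] := h a (mem_head _ _).
  exists (maxn l m) => b; rewrite inE => /predU1P[->|/hm].
    exact: le_J (leq_maxl _ _) hl.
  exact: le_J (leq_maxr _ _).
exists n => m x Jx; have /hs : exists n, J n x by exists m.
by apply.
Qed.

Lemma noetherian_ind (Q : (R -> Prop) -> Prop) :
  (forall J, ideal J ->
     (forall K, ideal K -> (forall x, J x -> K x) ->
        (exists2 x, K x & ~ J x) -> Q K) -> Q J) ->
  forall J, ideal J -> Q J.
Proof.
move=> step J iJ; apply: contrapT => nQJ.
pose B := {K : R -> Prop | ideal K /\ ~ Q K}.
have next (K : B) : {K' : B | (forall x, sval K x -> sval K' x) /\
    exists2 x, sval K' x & ~ sval K x}.
  apply: cid; case: K => K [iK nQK] /=.
  apply: contrapT => h; apply: nQK; apply: step => // K' iK' sub str.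
  by apply: contrapT => nQK'; apply: h; exists (exist _ K' (conj iK' nQK')).
pose K0 : B := exist _ J (conj iJ nQJ).
pose F n := iter n (fun K => sval (next K)) K0.
have [||n hn] := @noetherian_chain (fun n => sval (F n)).
- by move=> n; case: (svalP (F n)).
- by move=> n x; rewrite /F /=; case: (next _) => K' [h _] /=; apply: h.
have := hn n.+1; rewrite {1}/F iterS -/(F n).
by case: (next (F n)) => K' [_ [x hx hn']] /= /(_ x hx).
Qed.

Lemma primary_decomposition_exists J : ideal J ->
  exists (T : finType) (q : T -> R -> Prop), primary_decomposition J q.
Proof.
move: J; apply: noetherian_ind => J iJ IH.
have [J1|nJ1] := pselect (J 1).
  exists void, (fun=> fun=> True); split=> [[]|x]; split=> // _.
  by rewrite -(mulr1 x); apply: idealM.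
have [pJ|] := pselect (forall x y, J (x * y) -> J x \/ radical J y).
  by exists unit, (fun=> J); split=> [_|x]; split=> //; apply; exact: tt.
move=> /existsNP[a /existsNP[b /not_implyP[Jab /not_orP[nJa nJb]]]].
pose C n x := J (x * b ^+ n).
have iC n : ideal (C n).
  split=> [|x y|c x]; rewrite /C.
  - by rewrite mul0r; apply: (ideal0 iJ).
  - by rewrite mulrDl; apply: (idealD iJ).
  - by rewrite -mulrA; apply: (idealM iJ).
have incC n x : C n x -> C n.+1 x.
  by rewrite /C exprSr mulrA; apply: (idealMr _ iJ).
have [n0 hn0] := noetherian_chain iC incC.
have [n [n_gt0 hn]] : exists n, (0 < n)%N /\ forall m x, C m x -> C n x.
  by exists n0.+1; split=> // m x /hn0; apply: incC.
pose D x := exists j r, J j /\ x = j + r * b ^+ n.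
have iD : ideal D.
  split=> [|x y [j [r [hj ->]]] [j' [r' [hj' ->]]]|c x [j [r [hj ->]]]].
  - by exists 0, 0; rewrite mul0r addr0; split=> //; apply: (ideal0 iJ).
  - exists (j + j'), (r + r'); split; first exact: (idealD iJ).
    by rewrite mulrDl addrACA.
  - exists (c * j), (c * r); split; first exact: (idealM iJ).
    by rewrite mulrDr mulrA.
have subD x : J x -> D x by exists x, 0; rewrite mul0r addr0.
have subC x : J x -> C n x by apply: (idealMr _ iJ).
have Da : D (b ^+ n) by exists 0, 1; rewrite mul1r add0r; split=> //; apply: (ideal0 iJ).
have Ca : C n a.
  by rewrite /C -(prednK n_gt0) exprS mulrA; apply: (idealMr _ iJ).
have [T1 [q1 [prim1 E1]]] : exists (T : finType) (q : T -> R -> Prop),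
    primary_decomposition D q.
  by apply: IH => //; exists (b ^+ n) => // h; apply: nJb; exists n.
have [T2 [q2 [prim2 E2]]] : exists (T : finType) (q : T -> R -> Prop),
    primary_decomposition (C n) q.
  by apply: IH => //; exists a.
exists (T1 + T2)%type, (fun t => match t with inl i => q1 i | inr i => q2 i end).
split=> [[i|i]//|x]; split=> [Jx [i|i]|h].
- by apply/E1: i; apply: subD.
- by apply/E2: i; apply: subC.
have [j [r [Jj xE]]] : D x by apply/E1 => i; apply: (h (inl i)).
have Cx : C n x by apply/E2 => i; apply: (h (inr i)).
have : C (n + n)%N r.
  rewrite /C exprD mulrA -[r * _](addKr j) -xE mulrDl mulNr.
  by rewrite addrC; apply: (idealB iJ) => //; apply: (idealMr _ iJ).
by move=> /hn; rewrite /C xE => ?; apply: (idealD iJ).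
Qed.

Lemma primaryI q q' : primary_ideal q -> primary_ideal q' ->
  (forall x, radical q x <-> radical q' x) ->
  primary_ideal (fun x => q x /\ q' x).
Proof.
move=> [iq q1 qM] [iq' _ qM'] E; split.
- split=> [|x y [? ?] [? ?]|c x [? ?]]; split;
    by [apply: ideal0|apply: idealD|apply: idealM].
- by case.
have rad y : radical q y -> radical (fun x => q x /\ q' x) y.
  move=> qy; have /E [b hb] := qy; case: qy => a ha.
  exists (a + b)%N; rewrite exprD.
  by split; [apply: idealMr|apply: idealM].
move=> x y [/qM [qx|/rad]]; last by right.
by move=> /qM' [|/E/rad]; [left|right].
Qed.

Lemma minimal_primary_decomposition_exists J : ideal J ->
  exists (T : finType) (q : T -> R -> Prop), minimal_primary_decomposition J q.
Proof.
move=> iJ.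
pose D n := `[< exists (T : finType) (q : T -> R -> Prop),
  #|T| = n /\ primary_decomposition J q >].
have exD : exists n, D n.
  have [T [q dq]] := primary_decomposition_exists iJ.
  by exists #|T|; apply/asboolP; exists T, q.
case: (ex_minnP exD) => n /asboolP[T [q [cT [prim E]]]] minn.
have smaller (i : T) (q' : {x : T | x != i} -> R -> Prop) :
    primary_decomposition J q' -> False.
  move=> dq'; have /minn : D #|{: {x : T | x != i}}| by apply/asboolP; exists {x : T | x != i}, q'.
  rewrite card_sig leqNgt -cT => /negP; apply.
  rewrite [ltnRHS](cardD1 i) inE add1n ltnS; apply: subset_leq_card.
  by apply/fintype.subsetP => x; rewrite !inE => ->.
exists T, q; split=> // [i j rij|i].
  apply: contrapT => /eqP nij; have nji : j != i by rewrite eq_sym.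
  apply: (@smaller i (fun x => if val x == j then
      fun y => q i y /\ q j y else q (val x))); split=> [x|y].
    by case: ifP => _ //; apply: primaryI.
  rewrite E; split=> [h x|h k]; first by case: ifP.
  have [->|nki] := eqVneq k i.
    by have := h (exist _ j nji); rewrite /= eqxx => -[].
  have := h (exist _ k nki); rewrite /=; case: eqP => [->|//] [_].
  by [].
apply: contrapT => h; apply: (@smaller i (fun x => q (val x))).
split=> [x //|y]; rewrite E; split=> [qy x //|qy k].
have [->|nki] := eqVneq k i; last exact: (qy (exist _ k nki)).
apply: contrapT => nqi; apply: h; exists y => // j nji.
exact: (qy (exist _ j nji)).
Qed.

Lemma primary_component_exists I P m : minimal_prime I P ->
  exists q, primary_component (ideal_exp I m.+1) P q.
Proof.
case=> pP subP minP.
have [T [Q dQ]] := minimal_primary_decomposition_exists (ideal_expP I m.+1).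
have [[prim E] _ _] := dQ.
suff [i hi] : exists i, forall x, Q i x -> P x.
  exists (Q i), T, Q; split=> //; exists i; split=> // x; split.
    exact: radical_sub.
  apply: minP; first exact: radical_prime.
    apply: (prime_ideal_exp (m := m.+1)); first exact: radical_prime.
    by move=> y /E /(_ i) hy; exists 1%N.
  exact: radical_sub.
apply: contrapT => /forallNP h.
have /choice[s hs] : forall i, exists x, Q i x /\ ~ P x.
  by move=> i; have /not_forall_sub[x] := h i; exists x.
apply: (@prime_prod P T s predT pP); first by move=> i _; case: (hs i).
have [iP _ _] := pP.
have subPm x : ideal_exp I m.+1 x -> P x.
  by apply=> // _ [u [v [hu _ ->]]]; apply: idealMr => //; apply: subP.
apply: subPm; apply/E => i; rewrite (bigD1 i) //=.
by case: (prim i) => iQ _ _; apply: idealMr => //; case: (hs i).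
Qed.

End NoetherianInduction.

Lemma primary_componentE I P m q : minimal_prime I P ->
  primary_component (ideal_exp I m) P q ->
  forall x, q x <-> exists2 s, ~ P s & ideal_exp I m (s * x).
Proof.
move=> [pP subP minP] [T [Q [[[prim E] dist _] [i [Qi radi]]]]] x.
split=> [qx|[s nPs /E /(_ i)]]; last first.
  case: (prim i) => iQ _ QM; rewrite mulrC => /QM[/Qi//|].
  by move=> /radi.
have hj j : j != i -> exists s, Q j s /\ ~ P s.
  move=> nji; suff: ~ forall x, Q j x -> P x by move=> /not_forall_sub[s]; exists s.
  move=> sub; move: nji; suff -> : j = i by rewrite eqxx.
  apply: dist => y; rewrite radi; split; first exact: radical_sub.
  apply: minP; first exact: radical_prime.
    apply: (prime_ideal_exp (m := m)); first exact: radical_prime.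
    by move=> z /E /(_ j) hz; exists 1%N.
  exact: radical_sub.
have /choice[s hs] : forall j, exists s, j != i -> Q j s /\ ~ P s.
  move=> j; have [->|/hj[s hs]] := eqVneq j i; first by exists 0.
  by exists s.
exists (\prod_(j | j != i) s j).
  by apply: prime_prod => // j /hs[].
apply/E => j; case: (prim j) => iQ _ _.
have [->|nji] := eqVneq j i.
  by case: (prim i) => iQi _ _; apply: idealM => //; apply/Qi.
rewrite (bigD1 j) //= -mulrA; apply: idealMr => //.
by case: (hs j nji).
Qed.

Section SymbolicPower.
Hypothesis noethR : noetherian.

Lemma symbolic_powerE I m x : symbolic_power I m.+1 x <->
  forall P, minimal_prime I P -> exists2 s, ~ P s & ideal_exp I m.+1 (s * x).
Proof.
split=> [h P mP|h P mP q qP].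
  have [q qP] := primary_component_exists noethR m mP.
  by have /(primary_componentE mP qP) := h P mP q qP.
exact/(primary_componentE mP qP)/h.
Qed.

Lemma symbolic_power_ideal I m : ideal (symbolic_power I m).
Proof.
case: m => [//|m]; have iE := ideal_expP I m.+1.
split=> [|x y|c x] .
- by apply/symbolic_powerE => P [[_ P1 _] _ _]; exists 1; rewrite // mulr0; apply: (ideal0 iE).
- move=> /symbolic_powerE hx /symbolic_powerE hy.
  apply/symbolic_powerE => P mP; have [s ns hs] := hx P mP.
  have [t nt ht] := hy P mP; case: (mP) => [[_ _ PM] _ _].
  exists (s * t); first by move=> /PM[].
  rewrite mulrDr; apply: (idealD iE); last by rewrite -mulrA; apply: (idealM iE).
  by rewrite mulrAC; apply: (idealMr _ iE).
- move=> /symbolic_powerE hx; apply/symbolic_powerE => P mP.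
  have [s ns hs] := hx P mP; exists s => //.
  by rewrite mulrCA; apply: (idealM iE).
Qed.

Lemma symbolic_power_mul I a b x y : symbolic_power I a x ->
  symbolic_power I b y -> symbolic_power I (a + b) (x * y).
Proof.
case: a => [|a] hx hy.
  by rewrite add0n; apply: (idealM (symbolic_power_ideal _ _)).
case: b hy => [|b] hy.
  by rewrite addn0; apply: (idealMr _ (symbolic_power_ideal _ _)).
move: hx hy => /symbolic_powerE hx /symbolic_powerE hy.
rewrite addSn; apply/symbolic_powerE => P mP; have [s ns hs] := hx P mP.
have [t nt ht] := hy P mP; case: (mP) => [[_ _ PM] _ _].
exists (s * t); first by move=> /PM[].
by rewrite mulrACA -addSn; apply: ideal_exp_mul.
Qed.

End SymbolicPower.
End Ideals.

Section HilbertBasis.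

Lemma noetherian_field (k : fieldType) : noetherian k.
Proof.
move=> I iI; have [[a Ia a0]|h] := pselect (exists2 a, I a & a != 0).
  exists [:: a] => x; split=> [_|].
    rewrite -(divfK a0 x); apply: (idealM (ideal_genP _)).
    by apply: ideal_gen_sub; rewrite mem_head.
  by apply=> // b; rewrite inE => /eqP ->.
exists [::] => x; split=> [Ix|]; last by apply.
have [->|x0] := eqVneq x 0; first exact: (ideal0 (ideal_genP _)).
by case: h; exists x.
Qed.

Lemma noetherian_surj (R S : comNzRingType) (f : {rmorphism R -> S}) :
  (forall y, exists x, f x = y) -> noetherian R -> noetherian S.
Proof.
move=> fsurj nR I iI.
have iJ : ideal (fun x => I (f x)).
  split=> [|x y|c x]; rewrite ?rmorph0 ?rmorphD ?rmorphM.
  - exact: ideal0.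
  - exact: idealD.
  - exact: idealM.
have [s hs] := nR _ iJ; exists [seq f a | a <- s] => y; split.
  have [x <-] := fsurj y => /hs h.
  apply: (h (fun z => ideal_gen (fun b => b \in [seq f a | a <- s]) (f z))).
    have iG := @ideal_genP S (fun b => b \in [seq f a | a <- s]).
    split=> [|u v|c u]; rewrite ?rmorph0 ?rmorphD ?rmorphM.
    - exact: (ideal0 iG).
    - exact: (idealD iG).
    - exact: (idealM iG).
  by move=> a sa; apply: ideal_gen_sub; apply: map_f.
by apply=> // _ /mapP[a sa ->]; apply/hs; apply: ideal_gen_sub.
Qed.

Lemma noetherian_poly (R : comNzRingType) :
  noetherian R -> noetherian {poly R}.
Proof.
move=> nR I iI.
pose L d a := exists p : {poly R}, [/\ I p, (size p <= d.+1)%N & p`_d = a].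
have size_mulC (c : R) (p : {poly R}) d :
    (size p <= d)%N -> (size (c%:P * p)%R <= d)%N.
  by rewrite mul_polyC; apply: leq_trans (size_scale_leq _ _).
have lead_ideal (J : {poly R} -> Prop) d : ideal J ->
    ideal (fun a => exists p : {poly R}, [/\ J p, (size p <= d.+1)%N & p`_d = a]).
  move=> iJ; split=> [|_ _ [p [Jp sp <-]] [q [Jq sq <-]]|c _ [p [Jp sp <-]]].
  - by exists 0; rewrite size_poly0 coef0; split=> //; apply: ideal0.
  - exists (p + q); rewrite coefD; split=> //; first exact: idealD.
    by apply: leq_trans (size_polyD _ _) _; rewrite geq_max sp sq.
  - exists (c%:P * p); rewrite coefCM; split=> //; first exact: idealM.
    exact: size_mulC.
have iL d : ideal (L d) by apply: lead_ideal.
have incL d a : L d a -> L d.+1 a.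
  move=> [p [Ip sp <-]]; exists ('X * p); split; first exact: idealM.
    by apply: leq_trans (size_polyMleq _ _) _; rewrite size_polyX.
  by rewrite coefXM.
have [N hN] := noetherian_chain nR iL incL.
have genL d : exists g : seq {poly R}, (forall p, p \in g -> I p) /\
    forall a, L d a -> exists p, [/\ ideal_gen (fun h => h \in g) p,
      (size p <= d.+1)%N & p`_d = a].
  have [s hs] := nR _ (iL d).
  have : forall a, a \in s -> L d a.
    by move=> a sa; apply/hs; apply: ideal_gen_sub.
  suff: (forall a, a \in s -> L d a) ->
      exists g : seq {poly R}, (forall p, p \in g -> I p) /\
        forall a, a \in s -> exists p, [/\ p \in g, (size p <= d.+1)%N & p`_d = a].
    move=> h /h[g [gI gs]]; exists g; split=> // a /hs ha.
    apply: (ha _ (lead_ideal _ d (@ideal_genP _ (fun h => h \in g)))).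
    by move=> b /gs[p [? ? ?]]; exists p; split=> //; apply: ideal_gen_sub.
  elim: (s) => [|a t IH] h; first by exists [::].
  have [g [gI gt]] : exists g : seq {poly R}, (forall p, p \in g -> I p) /\
        forall a, a \in t -> exists p, [/\ p \in g, (size p <= d.+1)%N & p`_d = a].
    by apply: IH => b tb; apply: h; rewrite inE tb orbT.
  have [p [Ip sp pa]] := h a (mem_head _ _).
  exists (p :: g); split=> [q|b]; first by rewrite inE => /predU1P[->|/gI].
  rewrite inE => /predU1P[->|/gt[q [gq sq qb]]].
    by exists p; rewrite mem_head.
  by exists q; rewrite inE gq orbT.
have [g hg] := choice genL.
pose G := flatten [seq g d | d <- iota 0 N.+1].
have memG d p : (d <= N)%N -> p \in g d -> p \in G.
  move=> dN gp; apply/flattenP; exists (g d) => //.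
  by apply: map_f; rewrite mem_iota.
have GI p : p \in G -> I p.
  by move=> /flattenP[_ /mapP[d _ ->]]; case: (hg d) => h _; apply: h.
have iG := @ideal_genP {poly R} (fun h => h \in G).
have genG d p : (d <= N)%N -> ideal_gen (fun h => h \in g d) p ->
    ideal_gen (fun h => h \in G) p.
  by move=> dN; apply=> // h /(memG _ _ dN) hG; apply: ideal_gen_sub.
have lead d a : L d a -> exists p, [/\ ideal_gen (fun h => h \in G) p,
      (size p <= d.+1)%N & p`_d = a].
  move=> La; have [dN|/ltnW Nd] := leqP d N.
    have [_ /(_ _ La)[p [hp sp pa]]] := hg d.
    by exists p; split=> //; apply: (genG d).
  have [_ /(_ _ (hN _ _ La))[p [hp sp pa]]] := hg N.
  exists ('X^(d - N) * p); split; first by apply: (idealM iG); apply: (genG N).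
    apply: leq_trans (size_polyMleq _ _) _; rewrite size_polyXn addSn /=.
    by apply: leq_trans (leq_add (leqnn _) sp) _; rewrite addnS subnK.
  by rewrite coefXnM ltnNge leq_subr /= subKn.
exists G => p; split=> [|]; last by apply.
have [n] := ubnP (size p); elim: n p => // n IH p; rewrite ltnS => sp Ip.
case: n => [|d] in IH sp *.
  by move: sp; rewrite leqn0 size_poly_eq0 => /eqP ->; apply: (ideal0 iG).
have [q [Gq sq qp]] : exists q, [/\ ideal_gen (fun h => h \in G) q,
      (size q <= d.+1)%N & q`_d = p`_d] by apply: lead; exists p.
rewrite -(subrK q p); apply: (idealD iG) => //; apply: IH.
  rewrite ltnS; apply/leq_sizeP => j; rewrite leq_eqVlt => /predU1P[<-|dj].
    by rewrite coefB qp subrr.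
  by rewrite coefB !nth_default ?subrr //; apply: leq_trans dj.
by apply: idealB => //; apply: Gq.
Qed.

Lemma noetherian_mpoly (k : fieldType) n : noetherian {mpoly k[n]}.
Proof.
elim: n => [|n IH].
  apply: (@noetherian_surj k _ (@mpolyC 0 k)); last exact: noetherian_field.
  by move=> p; exists p@_0%MM; rewrite [RHS]nvar0_mpolyC.
pose f0 : {rmorphism {mpoly k[n]} -> {mpoly k[n.+1]}} := @mwiden n k.
have comm : commr_rmorph f0 ('X_ord_max : {mpoly k[n.+1]}).
  by move=> c; apply: mulrC.
pose h : {rmorphism {poly {mpoly k[n]}} -> {mpoly k[n.+1]}} := horner_morph comm.
apply: (@noetherian_surj {poly {mpoly k[n]}} {mpoly k[n.+1]} h); last exact: noetherian_poly.
have imC c : h (c%:MP)%:P = c%:MP by rewrite [LHS]horner_morphC /= mwidenC.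
have imX (i : 'I_n.+1) : exists x, h x = 'X_i.
  case: (unliftP ord_max i) => [j|] ->.
    exists ('X_j)%:P; rewrite [LHS]horner_morphC /= mwidenX mnmwiden1.
    by congr 'X_[U_(_)]; apply: val_inj; rewrite /= /bump leqNgt ltn_ord.
  by exists 'X; apply: horner_morphX.
elim/mpolyind => [|c m p _ _ [x xE]]; first by exists 0; rewrite rmorph0.
have [f fE] := choice imX.
exists ((c%:MP)%:P * \prod_i f i ^+ m i + x).
rewrite rmorphD rmorphM xE imC mul_mpolyC rmorph_prod mpolyXE_id.
congr (_ *: _ + _); apply: eq_bigr => i _.
by rewrite rmorphXn fE.
Qed.

End HilbertBasis.

(* The ring R^{1/q}, q = p ^ e, for R reduced of characteristic p: a copy of R
   in which [x] stands for x^{1/q}.  As x |-> x ^+ q is additive, sums and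
   products of q-th roots are those of R; a : R is the q-th root of a ^ q, so
   that a *: x^{1/q} = (a ^ q * x)^{1/q}. *)
Section FrobeniusRoot.
Variables (R : comNzRingType) (p : nat).

Definition qroot (chR : p \in [pchar R]) (e : nat) : predArgType := R.

Variables (chR : p \in [pchar R]) (e : nat).
Local Notation Rq := (qroot chR e).

HB.instance Definition _ := GRing.ComNzRing.on Rq.

Definition to_qroot (x : R) : Rq := x.

Definition qroot_scale (a : R) (x : Rq) : Rq := to_qroot (a ^+ (p ^ e) * x).

Let qexpD : {morph (fun a : R => a ^+ (p ^ e)) : a b / a + b}.
Proof. by move=> a b /=; rewrite exprDn_pchar // pnatX (eq_pnat _ (pcharf_eq chR)) pnat_id ?(pcharf_prime chR). Qed.

Fact qroot_scaleA a b x :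
  qroot_scale a (qroot_scale b x) = qroot_scale (a * b) x.
Proof. by rewrite /qroot_scale /to_qroot exprMn mulrA. Qed.

Fact qroot_scale1 : left_id 1 qroot_scale.
Proof. by move=> x; rewrite /qroot_scale expr1n mul1r. Qed.

Fact qroot_scaleDr : right_distributive qroot_scale +%R.
Proof. by move=> a x y; rewrite /qroot_scale /to_qroot mulrDr. Qed.

Fact qroot_scaleDl x : {morph qroot_scale^~ x : a b / a + b}.
Proof. by move=> a b; rewrite /qroot_scale /to_qroot qexpD mulrDl. Qed.

HB.instance Definition _ := GRing.Zmodule_isLmodule.Build R Rq
  qroot_scaleA qroot_scale1 qroot_scaleDr qroot_scaleDl.

Fact qroot_scaleAl (a : R) (x y : Rq) : a *: (x * y) = (a *: x) * y.
Proof. exact: mulrA. Qed.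

HB.instance Definition _ := GRing.Lmodule_isLalgebra.Build R Rq qroot_scaleAl.

Fact qroot_scaleAr (a : R) (x y : Rq) : a *: (x * y) = x * (a *: y).
Proof. exact: mulrCA. Qed.

HB.instance Definition _ := GRing.Lalgebra_isAlgebra.Build R Rq qroot_scaleAr.

Lemma to_qrootX (x : R) : to_qroot x ^+ (p ^ e) = x%:A.
Proof. by rewrite [RHS]mulr1. Qed.

End FrobeniusRoot.

Definition F_finite (R : comNzRingType) (p : nat) (chR : p \in [pchar R]) :
    Prop :=
  forall e, exists s : seq (qroot chR e), forall x : qroot chR e,
    exists a : 'I_(size s) -> R, x = \sum_i a i *: s`_i.

(* The first two clauses are the standing assumptions of the notion; a domain
   is in particular reduced. *)
Definition strongly_F_regular (R : comNzRingType) (p : nat)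
    (chR : p \in [pchar R]) : Prop :=
  [/\ GRing.integral_domain_axiom R, noetherian R &
      forall c : R, (forall P, minimal_prime (fun x => x = 0) P -> ~ P c) ->
      exists e, exists phi : {linear qroot chR e -> R^o},
        forall r : R, phi (r *: to_qroot chR e c) = r].

Section SymbolicRees.
Variables (k : fieldType) (n : nat).
Local Notation S := {mpoly k[n]}.
Variable I : S -> Prop.

Definition symbolic_rees_pred : {pred {poly S}} :=
  fun F => `[< forall m, symbolic_power I m F`_m >].

Fact symbolic_rees_subring : subring_closed symbolic_rees_pred.
Proof.
have iI := symbolic_power_ideal (@noetherian_mpoly k n) I.
split=> [|F G /asboolP hF /asboolP hG|F G /asboolP hF /asboolP hG];
  apply/asboolP => m.
- rewrite coef1; case: m => [//|m] /=.
  exact: (ideal0 (iI m.+1)).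
- by rewrite coefB; apply: (idealB (iI m)).
rewrite coefM; apply: (big_ind (symbolic_power I m)).
- exact: (ideal0 (iI m)).
- exact: (idealD (iI m)).
move=> i _; rewrite -[m in symbolic_power I m](subnKC (ltn_ord i : (i <= m)%N)).
exact: (symbolic_power_mul (@noetherian_mpoly k n)).
Qed.

HB.instance Definition _ := GRing.isSubringClosed.Build {poly S}
  symbolic_rees_pred symbolic_rees_subring.

Record symbolic_rees : predArgType := SymbolicRees {
  symbolic_rees_val :> {poly S};
  _ : symbolic_rees_val \in symbolic_rees_pred }.

HB.instance Definition _ := [isSub for symbolic_rees_val].
HB.instance Definition _ := [Choice of symbolic_rees by <:].
HB.instance Definition _ := [SubChoice_isSubComNzRing of symbolic_rees by <:].

Lemma symbolic_rees_pchar p : p \in [pchar k] -> p \in [pchar symbolic_rees].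
Proof.
rewrite !inE => /andP[-> /eqP p0] /=; apply/eqP/val_inj.
by rewrite rmorph_nat rmorph0 -polyC_natr -mpolyC_nat p0 mpolyC0 polyC0.
Qed.

End SymbolicRees.

Record sgraph (T : finType) := SGraph {
  edge :> rel T;
  edge_sym : ssrbool.symmetric edge;
  edge_irr : irreflexive edge }.

Definition sgraph_iso (T U : finType) (G : sgraph T) (H : sgraph U) : Prop :=
  exists2 f : T -> U, bijective f & forall x y, H (f x) (f y) = G x y.

Local Obligation Tactic := idtac.

Program Definition induced (T : finType) (G : sgraph T) (A : {set T}) :
    sgraph {x : T | x \in A} :=
  @SGraph _ (fun x y => G (val x) (val y)) _ _.
Next Obligation. by move=> T G A x y; apply: edge_sym. Qed.
Next Obligation. by move=> T G A x; apply: edge_irr. Qed.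

Program Definition complete_graph (r : nat) : sgraph 'I_r :=
  @SGraph _ (fun x y => x != y) _ _.
Next Obligation. by move=> r x y; rewrite eq_sym. Qed.
Next Obligation. by move=> r x; rewrite eqxx. Qed.

Program Definition path_graph (r : nat) : sgraph 'I_r :=
  @SGraph _ (fun x y => (x.+1 == y :> nat) || (y.+1 == x :> nat)) _ _.
Next Obligation. by move=> r x y; rewrite orbC. Qed.
Next Obligation. by move=> r x; rewrite eqn_leq ltnn. Qed.

Program Definition clique_join (T : finType) (H : sgraph T) (w1 w2 : T)
    (t : nat) : sgraph (T + 'I_(t - 2))%type :=
  @SGraph _ (fun u v => match u, v with
    | inl x, inl y => H x y
    | inl x, inr _ | inr _, inl x => (x == w1) || (x == w2)
    | inr i, inr j => i != j
    end) _ _.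
Next Obligation.
by move=> T H w1 w2 t [x|i] [y|j] //=; [apply: edge_sym|rewrite eq_sym].
Qed.
Next Obligation. by move=> T H w1 w2 t [x|i] /=; rewrite ?edge_irr ?eqxx. Qed.

Program Definition add_whisker (T : finType) (H : sgraph T) (v : T) :
    sgraph (option T) :=
  @SGraph _ (fun x y => match x, y with
    | Some x, Some y => H x y
    | Some x, None | None, Some x => x == v
    | None, None => false
    end) _ _.
Next Obligation. by move=> T H v [x|] [y|] //=; apply: edge_sym. Qed.
Next Obligation. by move=> T H v [x|] //=; rewrite edge_irr. Qed.

Definition net : sgraph (option (option (option 'I_3))) :=
  let v i := inord i : 'I_3 in
  add_whisker (add_whisker (add_whisker (complete_graph 3) (v 0%N))
    (Some (v 1%N))) (Some (Some (v 2%N))).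

Definition net_free (T : finType) (G : sgraph T) : Prop :=
  ~ exists A : {set T}, sgraph_iso (induced G A) net.

(* [clique_joined H f used]: [H] arises from the path on [r] vertices by clique
   joins via pairwise distinct edges of the path, [used] being the edges already
   used and [f] the embedding of the path's vertices into those of [H]. *)
Inductive clique_joined (r : nat) : forall T : finType,
    sgraph T -> ('I_r -> T) -> seq {set 'I_r} -> Prop :=
| CliqueJoined0 : clique_joined (path_graph r) id [::]
| CliqueJoinedS (T : finType) (H : sgraph T) (f : 'I_r -> T)
    (used : seq {set 'I_r}) (w1 w2 : 'I_r) (t : nat) :
    clique_joined H f used -> path_graph r w1 w2 -> [set w1; w2] \notin used ->
    (3 <= t)%N ->
    clique_joined (clique_join H (f w1) (f w2) t) (fun i => inl (f i))
      ([set w1; w2] :: used).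

(* [whiskered H H' g]: [H'] arises from [H] by adding whiskers at vertices of
   [H], embedded in [H'] by [g]; no whisker is added at the end of another. *)
Inductive whiskered (T : finType) (H : sgraph T) : forall U : finType,
    sgraph U -> (T -> U) -> Prop :=
| Whiskered0 : whiskered H H id
| WhiskeredS (U : finType) (H' : sgraph U) (g : T -> U) (v : T) :
    whiskered H H' g ->
    whiskered H (add_whisker H' (g v)) (fun x => Some (g x)).

Definition generalized_caterpillar (V : finType) (G : sgraph V) : Prop :=
  exists r (T : finType) (H : sgraph T) (f : 'I_r.+1 -> T) used
         (U : finType) (H' : sgraph U) (g : T -> U),
    [/\ clique_joined H f used, whiskered H H' g & sgraph_iso H' G].

Section BinomialEdgeIdeal.
Variables (k : fieldType) (n : nat).

Definition xvar (i : 'I_n) : {mpoly k[n + n]} := 'X_(lshift n i).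
Definition yvar (i : 'I_n) : {mpoly k[n + n]} := 'X_(rshift n i).

Definition binomial_edge_ideal (G : sgraph 'I_n) : {mpoly k[n + n]} -> Prop :=
  ideal_gen (fun h => exists i j,
    G i j /\ h = xvar i * yvar j - yvar i * xvar j).

End BinomialEdgeIdeal.

Arguments binomial_edge_ideal k {n} G _.

(* Main.v *)
From HB Require Import structures.
From mathcomp Require Import all_boot all_order all_fingroup all_algebra.
From mathcomp Require Import boolp zify ring.
From mathcomp Require Import mpoly.
Require Import Defs.

(** A net-free generalized caterpillar is a chain of cliques with whiskers at
    the spine vertices, so that its vertices can be listed as [v_1, .., v_n] in
    such a way that every vertex lying strictly between the ends of an edge is
    simplicial and adjacent to the later end.  Let
    [f = y_(v_1) f_(v_1,v_2) .. f_(v_(n-1),v_n) x_(v_n)].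

    If [P] is a minimal prime of [J_G], let [T] be the set of the [i] with
    [x_i, y_i] in [P].  Minimality gives each [i] in [T] two neighbours [j], [l]
    with [f_(j,l)] outside [P].  It follows that, locally at [P], the ideal [J_G]
    is generated by the [x_i], [y_i] with [i] in [T] and by the factors
    [f_(v_m,v_(m+1))] of [f] which lie in [J_G] and do not involve [T].  If [h] is
    the number of these generators, then [f] is in the [h]-th power of the ideal
    which they generate.

    Let [q = p ^ e], let [Tr] be a [q ^ (-1)]-linear map on [S] extracting the
    monomials whose exponents are all [-1] modulo [q], and let [c t ^ a] be a
    nonzero component of the element to be split.  For a suitable monomial [mu]
    and constant [N], the polynomial [f ^ (q - 1 - N) mu c] has leading monomial
    [(x_1 .. y_n) ^ (q - 1)], so that [Tr] can be scaled to send it to [1].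
    As [M >= h (q - 1) + q (i - 1) + 1] implies that the [M]-th power of an ideal
    with [h] generators lies in the Frobenius power of its [i]-th power, the map
    [F t ^ (q i + a) |-> Tr (f ^ (q - 1 - N) mu F) t ^ i] preserves the symbolic
    Rees algebra as soon as [q + a > h N]: this is the required splitting.

    Noetherianity comes from F-finiteness: by induction on the degree, the
    algebra is generated over [S] by the homogeneous components of its generators
    as a module over its [p]-th powers. *)

Set Implicit Arguments.
Unset Strict Implicit.
Unset Printing Implicit Defensive.

Import GRing.Theory Order.TTheory.
Local Open Scope ring_scope.

(** * Vertex orders of net-free generalized caterpillars *)

Section GraphOrders.
Local Open Scope nat_scope.

(** Written with adjacencies only, the condition passes through [Some] and graph isomorphisms by
    computation. That the six vertices are distinct follows from it. *)
Definition net_at (V : finType) (G : sgraph V) (v x y v' x' y' : V) : bool :=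
  [&& [&& G v x, G v y & G x y], [&& G v v', G x x' & G y y'],
      ~~ [|| G v x', G v y', G x v' | G x y'], ~~ (G y v' || G y x')
    & ~~ [|| G v' x', G v' y' | G x' y']].

Lemma net_free_at (V : finType) (G : sgraph V) v x y v' x' y' :
  net_free G -> ~~ net_at G v x y v' x' y'.
Proof.
move=> nfG; apply/negP => /and5P[/and3P[vx vy xy] /and3P[vv xx yy]].
rewrite !negb_or => /and4P[vx' vy' xv' xy'] /andP[yv' yx'] /and3P[v'x' v'y' x'y'].
pose h (z : option (option (option 'I_3))) : V :=
  match z with
  | None => y' | Some None => x' | Some (Some None) => v'
  | Some (Some (Some i)) => nth v [:: v; x; y] i
  end.
have ord3E (i : 'I_3) j : j < 3 -> (i == inord j) = (i == j :> nat).
  by move=> j3; rewrite -val_eqE /= inordK.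
have hE z t : G (h z) (h t) = net z t.
  have sym a b c : G a b = c -> (G a b = c) * (G b a = c).
    by move=> Gab; rewrite (edge_sym _ b a) Gab.
  have E := (sym _ _ _ vx, sym _ _ _ vy, sym _ _ _ xy, sym _ _ _ vv, sym _ _ _ xx,
    sym _ _ _ yy, sym _ _ _ (negbTE vx'), sym _ _ _ (negbTE vy'),
    sym _ _ _ (negbTE xv'), sym _ _ _ (negbTE xy'), sym _ _ _ (negbTE yv'),
    sym _ _ _ (negbTE yx'), sym _ _ _ (negbTE v'x'), sym _ _ _ (negbTE v'y'),
    sym _ _ _ (negbTE x'y')).
  by case: z t => [[[[[|[|[|//]]] ?]|]|]|] [[[[[|[|[|//]]] ?]|]|]|];
    rewrite /= ?(inj_eq Some_inj) ?(ord3E _ 0) ?(ord3E _ 1) ?(ord3E _ 2) // ?edge_irr ?E.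
(* The map [h] respects adjacency and no two vertices of the net have the same neighbours, so [h]
   cannot identify two of them. *)
have h_inj : injective h.
  move=> z t hzt; have {hzt} E u : net z u = net t u by rewrite -!hE hzt.
  have := (E None, E (Some None), E (Some (Some None)),
    E (Some (Some (Some (inord 0)))), E (Some (Some (Some (inord 1)))),
    E (Some (Some (Some (inord 2))))).
  move: z t {E} => [[[[[|[|[|//]]] ?]|]|]|] [[[[[|[|[|//]]] ?]|]|]|];
    rewrite /= ?(inj_eq Some_inj) ?(ord3E _ 0) ?(ord3E _ 1) ?(ord3E _ 2)
      ?inordK //= => -[[[[[]]]]] //;
    by move=> *; congr (Some (Some (Some _))); apply: val_inj.
apply: nfG; exists [set z | z \in codom h].
have hA z : h z \in [set z | z \in codom h] by rewrite inE codom_f.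
have Ah (z : {z | z \in [set z | z \in codom h]}) : val z \in codom h.
  by have := valP z; rewrite inE.
exists (fun z => iinv (Ah z)); last by move=> a b; rewrite -hE !f_iinv.
exists (fun z => Sub (h z) (hA z)) => z; first by apply: val_inj; rewrite /= f_iinv.
by apply: h_inj; rewrite f_iinv.
Qed.

Definition simplicial (V : finType) (G : sgraph V) (k : V) : Prop :=
  forall x y, G k x -> G k y -> x != y -> G x y.

Definition spanned (V : finType) (G : sgraph V) (rho : V -> nat) (a b k : V) :=
  [&& G a b, rho a < rho k & rho k < rho b].

(* [D] contains the vertices at which whiskers may still be attached. *)
Definition block_order (V : finType) (G : sgraph V) (D : pred V)
    (rho : V -> nat) : Prop :=
  [/\ injective rho,
      forall a b k, spanned G rho a b k ->
        [/\ simplicial G k, G k b & D k -> G k a]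
    & forall k x y, ~~ D k -> G k x -> G k y -> x = y].

(** * Absence of induced diamonds and 4-cycles *)

Section BlockOrderFacts.
Variables (V : finType) (G : sgraph V) (D : pred V) (rho : V -> nat).
Hypothesis rhoG : block_order G D rho.

(** If [u] and [u'] were not adjacent, neither [x] nor [y] would be simplicial, so [u] and [u']
    would lie between them. The edge from the earlier of [x], [y] to the later of [u], [u'] then
    spans the other one, which is thus adjacent to its later end. *)
Lemma block_order_common_nbr x y u u' : G x y -> G x u -> G y u -> G x u' ->
  G y u' -> u != u' -> G u u'.
Proof.
case: rhoG => rho_inj rhoS _.
wlog xy : x y / rho x < rho y => [hw Gxy|].
  have /orP[] : (rho x < rho y) || (rho y < rho x).
  - rewrite -neq_ltn; apply/eqP => /rho_inj xy.
    by move: Gxy; rewrite xy edge_irr.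
  - by move=> h *; apply: (hw x y).
  - by move=> h *; apply: (hw y x) => //; rewrite edge_sym.
have mid w w' : G x y -> G x w -> G y w -> G x w' -> G y w' -> w != w' ->
    ~~ G w w' -> rho x < rho w < rho y.
  move=> Gxy Gxw Gyw Gxw' Gyw' ww' nww'; apply/andP; split; rewrite ltnNge leq_eqVlt.
  - apply/negP => /orP[/eqP/rho_inj wx|wx].
      by move: Gxw; rewrite wx edge_irr.
    have [|sx _ _] := rhoS w y x; first by rewrite /spanned edge_sym Gyw wx.
    by move: (sx _ _ Gxw Gxw' ww'); apply/negP.
  - apply/negP => /orP[/eqP/rho_inj wy|wy].
      by move: Gyw; rewrite wy edge_irr.
    have [|sx _ _] := rhoS x w y; first by rewrite /spanned Gxw wy xy.
    by move: (sx _ _ Gyw Gyw' ww'); apply/negP.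
move=> Gxy Gxu Gyu Gxu' Gyu' uu'; apply: contraT => nuu'.
wlog lt_uu' : u u' Gxu Gyu Gxu' Gyu' uu' nuu' / rho u < rho u' => [hw|].
  have /orP[] : (rho u < rho u') || (rho u' < rho u).
  - by rewrite -neq_ltn; apply: contra uu' => /eqP/rho_inj ->.
  - exact: hw.
  - by apply: hw; rewrite // 1?eq_sym // edge_sym.
have /andP[xu _] := mid _ _ Gxy Gxu Gyu Gxu' Gyu' uu' nuu'.
have [|_ Guu' _] := rhoS x u' u; first by rewrite /spanned Gxu' xu.
by rewrite Guu' in nuu'.
Qed.

(** The later of [b] and [d] is spanned by the edge from the other one to [a], hence simplicial, and
    [a] and [c] are two of its neighbours. *)
Lemma block_order_max_C4 a b c d : G a b -> G b c -> G c d -> G d a ->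
  a != c -> b != d -> rho b <= rho a -> rho d <= rho a -> G a c.
Proof.
case: rhoG => rho_inj rhoS _ Gab Gbc Gcd Gda ac bd ba da.
have lt x : G a x -> rho x <= rho a -> rho x < rho a.
  rewrite leq_eqVlt => Gax /orP[/eqP/rho_inj xa|//].
  by move: Gax; rewrite xa edge_irr.
have Gad : G a d by rewrite edge_sym.
have /orP[lt_bd|lt_db] : (rho b < rho d) || (rho d < rho b).
- by rewrite -neq_ltn; apply: contra bd => /eqP/rho_inj ->.
- have [|sd _ _] := rhoS b a d; first by rewrite /spanned edge_sym Gab lt_bd lt.
  by apply: sd => //; rewrite edge_sym.
- have [|sb _ _] := rhoS d a b; first by rewrite /spanned Gda lt_db lt.
  by apply: sb => //; rewrite edge_sym.
Qed.

Lemma block_order_C4 a b c d : G a b -> G b c -> G c d -> G d a ->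
  a != c -> b != d -> G a c || G b d.
Proof.
move=> Gab Gbc Gcd Gda ac bd; apply/orP.
have ca : c != a by rewrite eq_sym.
have db : d != b by rewrite eq_sym.
have [ba|/ltnW ab] := leqP (rho b) (rho a);
  have [dc|/ltnW cd] := leqP (rho d) (rho c).
- have [ca'|/ltnW ac'] := leqP (rho c) (rho a).
    by left; apply: (@block_order_max_C4 a b c d) => //; apply: leq_trans ca'.
  by left; rewrite edge_sym; apply: (@block_order_max_C4 c d a b) => //; apply: leq_trans ac'.
- have [da|/ltnW ad] := leqP (rho d) (rho a).
    by left; apply: (@block_order_max_C4 a b c d).
  by right; rewrite edge_sym; apply: (@block_order_max_C4 d a b c).
- have [bc|/ltnW cb] := leqP (rho b) (rho c).
    by left; rewrite edge_sym; apply: (@block_order_max_C4 c d a b).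
  by right; apply: (@block_order_max_C4 b c d a).
- have [bd'|/ltnW db'] := leqP (rho b) (rho d).
    by right; rewrite edge_sym; apply: (@block_order_max_C4 d a b c) => //; apply: leq_trans bd'.
  by right; apply: (@block_order_max_C4 b c d a) => //; apply: leq_trans db'.
Qed.

End BlockOrderFacts.

Definition whisker_base (V : finType) (D : pred V) : pred (option V) :=
  fun z => if z is Some x then D x else false.

(** * Attaching a whisker *)

Section AddWhisker.
Variables (V : finType) (G : sgraph V) (D : pred V) (v : V).
Hypothesis Dv : D v.

(* The new leaf is inserted just before [v]. *)
Lemma whisker_unspanned rho : block_order G D rho ->
  (forall a b, ~~ spanned G rho a b v) ->
  exists rho', block_order (add_whisker G v) (whisker_base D) rho'.
Proof.
move=> [rho_inj rhoS rhoD] vS.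
exists (fun z => if z is Some x then (rho x).*2.+1 else (rho v).*2); split.
- move=> [x|] [y|] //; try by lia.
  by move=> /eqP; rewrite eqSS => /eqP/double_inj/rho_inj ->.
- move=> [a|] [b|] [k|] //; rewrite /spanned /=;
    try by (rewrite ?andbF // => /and3P[/eqP-> ? ?]; lia).
  + move=> /and3P[Gab ak kb]; have sk : spanned G rho a b k by rewrite /spanned Gab; lia.
    have [simk Gkb Dk] := rhoS _ _ _ sk; split=> // -[x|] [y|] //=.
    * by move=> Gkx Gky xy; apply: simk.
    * by move=> _ /eqP kv; move: sk; rewrite kv (negbTE (vS _ _)).
    * by move=> /eqP kv; move: sk; rewrite kv (negbTE (vS _ _)).
  (* An edge around the leaf ends at [v], as otherwise it would span [v]. *)
  + move=> /and3P[Gab ak kb]; have bv : b = v.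
      apply: rho_inj; apply/eqP; rewrite eqn_leq; apply/andP; split; last lia.
      by rewrite leqNgt; apply: contra (vS a b) => vb; rewrite /spanned Gab vb; lia.
    split=> //=; last by apply/eqP.
    by move=> [x|] [y|] //= /eqP -> /eqP ->; rewrite eqxx.
- move=> [k|] [x|] [y|] //=.
  + by move=> Dk Gx Gy; congr Some; apply: rhoD Gx Gy.
  + by move=> Dk _ /eqP kv; rewrite kv Dv in Dk.
  + by move=> Dk /eqP kv; rewrite kv Dv in Dk.
  + by move=> _ /eqP -> /eqP ->.
Qed.

(** The transposition of [v] and [w] is an automorphism of [G] which preserves [D]. *)
Lemma block_order_twins rho w : block_order G D rho -> D w ->
  (forall z, G v z && (z != w) = G w z && (z != v)) ->
  block_order G D (rho \o tperm v w).
Proof.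
move=> [rho_inj rhoS rhoD] Dw tw; set s := tperm v w.
have Gs x y : G (s x) (s y) = G x y.
  rewrite /s; case: tpermP => [->|->|/eqP xv /eqP xw];
    case: tpermP => [->|->|/eqP yv /eqP yw]; rewrite ?edge_irr //; try exact: edge_sym.
  - by have := tw y; rewrite yv yw !andbT.
  - by have := tw y; rewrite yv yw !andbT.
  - by rewrite ![G x _]edge_sym; have := tw x; rewrite xv xw !andbT.
  - by rewrite ![G x _]edge_sym; have := tw x; rewrite xv xw !andbT.
have Ds x : D (s x) = D x by rewrite /s; case: tpermP => [->|->|//]; rewrite Dv Dw.
split=> [|a b k|]; [exact: inj_comp rho_inj perm_inj| |exact: rhoD].
rewrite /spanned /= -Gs -/(spanned G rho _ _ _) => /rhoS[simk Gkb Dk].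
rewrite !Gs Ds in Gkb Dk; split=> // x y Gkx Gky xy; rewrite -Gs.
by apply: simk; rewrite ?Gs // (inj_eq perm_inj).
Qed.

(* If [v] lies strictly between the ends of an edge, then its closed
   neighbourhood is a clique, and as there is no net [v] is a twin of the first
   or of the last vertex of this clique.  After exchanging the two twins, [v] is
   no longer between the ends of an edge. *)
Lemma add_whisker_block_order rho : block_order G D rho ->
  (forall v0 x y v' x' y', ~~ net_at (add_whisker G v) v0 x y v' x' y') ->
  exists rho', block_order (add_whisker G v) (whisker_base D) rho'.
Proof.
move=> rhoG nf; have [rho_inj rhoS rhoD] := rhoG.
have [vS|] := pselect (forall a b, ~~ spanned G rho a b v).
  exact: whisker_unspanned rhoG vS.
move=> /existsNP[a /existsNP[b /negP/negPn vS]].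
have [simv Gvb /(_ Dv) Gva] := rhoS _ _ _ vS.
have /and3P[Gab av vb] := vS.
(* The candidates for the twin of [v] are its first neighbour [x] and its last neighbour [y]. *)
have [x Bx minx] := arg_minnP rho Gva.
have [y By maxy] := arg_maxnP rho Gvb.
have xa : rho x < rho v by apply: leq_ltn_trans (minx a Gva) av.
have yb : rho v < rho y by apply: leq_trans vb (maxy b Gvb).
have xy : x != y by apply: contraTneq xa => ->; rewrite -leqNgt ltnW.
have Gxy : G x y by apply: simv.
have twin z w : G v z -> G v w -> z != w -> (forall t, G z t -> t != v -> G v t) ->
    D z /\ forall t, G v t && (t != z) = G z t && (t != v).
  move=> Gvz Gvw zw sub; split.
    (* Outside [D] a vertex has at most one neighbour, but [z] is adjacent to [v] and to [w]. *)
    apply: contraT => Dz; have vw : v = w.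
      by apply: (rhoD _ _ _ Dz); [rewrite edge_sym|apply: simv].
    by move: Gvw; rewrite vw edge_irr.
  move=> t; apply/andP/andP => -[Gt tz].
    split; first by apply: simv => //; rewrite eq_sym.
    by apply: contraTneq Gt => ->; rewrite edge_irr.
  by split; [apply: sub|apply: contraTneq Gt => ->; rewrite edge_irr].
have swap z : D z -> (forall t, G v t && (t != z) = G z t && (t != v)) ->
    (forall t, G v t -> rho z <= rho t) \/ (forall t, G v t -> rho t <= rho z) ->
    G v z ->
    exists rho', block_order (add_whisker G v) (whisker_base D) rho'.
  move=> Dz tw ext Gvz; have rhoG' := block_order_twins rhoG Dz tw.
  apply: (whisker_unspanned rhoG') => c d; apply/negP => sp.
  (* Both ends of an edge spanning [v] are adjacent to [v], but [v] now stands before, or after, all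
     its neighbours. *)
  have [_ rhoS' _] := rhoG'; have [_ Gvd /(_ Dv) Gvc] := rhoS' _ _ _ sp.
  move: sp; rewrite /spanned /= tpermL => /and3P[_ cz zd].
  have ltz t : G v t -> G v (tperm v z t) || (t == z).
    move=> Gvt; case: tpermP => [tv|->|_ _]; rewrite ?eqxx ?orbT ?Gvt //.
    by move: Gvt; rewrite tv edge_irr.
  case: ext => ext.
    have := ltz c Gvc; case: eqP => [cz'|_]; last by rewrite orbF => /ext; rewrite leqNgt cz.
    by move: cz; rewrite cz' tpermR ltnNge (leq_trans (ext _ Gva) (ltnW av)).
  have := ltz d Gvd; case: eqP => [dz'|_]; last by rewrite orbF => /ext; rewrite leqNgt zd.
  by move: zd; rewrite dz' tpermR ltnNge (leq_trans (ltnW vb) (ext _ Gvb)).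
(* Neighbours [x'] of [x] and [y'] of [y] outside the closed neighbourhood of [v] will form a net
   with [v], [x], [y] and the new leaf. *)
have [subx|/existsNP[x' /not_implyP[Gxx' /not_implyP[x'v nx']]]] :=
    pselect (forall t, G x t -> t != v -> G v t).
  by have [Dx tw] := twin _ _ Bx By xy subx; apply: (swap x) => //; left.
have [suby|/existsNP[y' /not_implyP[Gyy' /not_implyP[y'v ny']]]] :=
    pselect (forall t, G y t -> t != v -> G v t).
  rewrite eq_sym in xy.
  by have [Dy tw] := twin _ _ By Bx xy suby; apply: (swap y) => //; right.
have sym c d : G c d -> G d c by rewrite edge_sym.
(* Otherwise [v] and [x'] are common neighbours of the adjacent [x] and [y], hence adjacent. *)
have nGx'y : ~~ G x' y.
  apply/negP => Gx'y; apply: nx'.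
  by apply: (block_order_common_nbr rhoG Gxy); rewrite 1?eq_sym // sym.
have nGy'x : ~~ G y' x.
  apply/negP => Gy'x; apply: ny'.
  by apply: (block_order_common_nbr rhoG Gxy); rewrite 1?eq_sym // sym.
(* Otherwise [x], [x'], [y'], [y] is a 4-cycle without a chord. *)
have nGx'y' : ~~ G x' y'.
  apply/negP => Gx'y'.
  have xy' : x != y' by apply: contra_not_neq ny' => <-.
  have x'y : x' != y by apply: contra_not_neq nx' => ->.
  have := block_order_C4 rhoG Gxx' Gx'y' (sym _ _ Gyy') (sym _ _ Gxy) xy' x'y.
  by rewrite [G x y']edge_sym (negbTE nGy'x) (negbTE nGx'y).
move: nf => /(_ (Some v) (Some x) (Some y) None (Some x') (Some y')).
case/negP; rewrite /net_at /= Bx By Gxy Gxx' Gyy' eqxx /=.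
rewrite (negbTE (introN idP nx')) (negbTE (introN idP ny')) (edge_sym G x y').
rewrite (negbTE nGy'x) (edge_sym G y x') (negbTE nGx'y) (negbTE nGx'y') (negbTE x'v) (negbTE y'v).
have -> : x == v = false by apply: contraTF xa => /eqP ->; rewrite ltnn.
by have -> : y == v = false by apply: contraTF yb => /eqP ->; rewrite ltnn.
Qed.

End AddWhisker.

(* The new vertices are inserted just before the later end of the edge used. *)
Lemma clique_joined_block_order r (T : finType) (H : sgraph T)
    (f : 'I_r -> T) used : clique_joined H f used ->
  exists rho,
    [/\ block_order H predT rho,
        {homo f : i j / (i < j)%N >-> rho i < rho j},
        forall i a b, ~~ spanned H rho a b (f i),
        forall i j, path_graph r i j -> H (f i) (f j)
      & forall i j : 'I_r, i.+1 = j -> [set i; j] \notin used ->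
          forall x, H x (f j) -> rho x < rho (f j) -> x = f i].
Proof.
elim=> {T H f used} [|T H f used w1 w2 t _ [rho [[rho_inj rhoS _] rhof fS fE fN]] w12 nused t3].
  have nS i (a b : 'I_r) : ~~ spanned (path_graph r) val a b i.
    by rewrite /spanned /=; lia.
  exists val; split=> //.
    split=> //; first exact: val_inj.
    by move=> a b k; rewrite (negbTE (nS _ _ _)).
  by move=> i j ij _ x /= xj lt_xj; apply: val_inj => /=; lia.
wlog w12E : w1 w2 w12 nused / w1.+1 = w2 :> nat => [hw|].
  have /orP[/eqP e|/eqP e] := w12; first exact: hw.
  have [||rho' [b1 b2 b3 b4 b5]] := hw w2 w1 _ _ e.
  - by rewrite edge_sym.
  - by rewrite finset.setUC.
  have swapE : clique_join H (f w2) (f w1) t =2 clique_join H (f w1) (f w2) t.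
    by move=> [x|x] [y|y] //=; rewrite orbC.
  have swapS a b k : spanned (clique_join H (f w1) (f w2) t) rho' a b k =
      spanned (clique_join H (f w2) (f w1) t) rho' a b k by rewrite /spanned swapE.
  exists rho'; split=> // [|i a b|i j ij].
  - case: b1 => c1 c2 c3; split=> // a b k; rewrite swapS => /c2[d1 d2 d3].
    by rewrite -!swapE; split=> // x y; rewrite -!swapE; apply: d1.
  - by rewrite swapS.
  - by rewrite (finset.setUC [set w1]) => h x; rewrite -swapE; apply: b5.
set lo := f w1; set hi := f w2; set d := t - 2.
have lohi : rho lo < rho hi by apply: rhof; rewrite -w12E.
have Hlh : H lo hi by apply: fE.
have fN' := fN _ _ w12E nused.
have f_inj : injective f.
  move=> i j ij; apply: val_inj; apply/eqP; rewrite eqn_leq.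
  apply/andP; split; rewrite leqNgt; apply/negP => /rhof; by rewrite ij ltnn.
(* Multiples of [d.+1] leave room for the [d] new vertices. The offset [d] of the old vertices puts
   the new ones, with offsets [i < d], just before [hi]. *)
pose rho' (z : T + 'I_d) : nat :=
  match z with inl x => rho x * d.+1 + d | inr i => rho hi * d.+1 + i end.
have ltL x y : (rho' (inl x) < rho' (inl y)) = (rho x < rho y).
  by rewrite /= ltn_add2r ltn_pmul2r.
have ltLR x (i : 'I_d) : (rho' (inl x) < rho' (inr i)) = (rho x < rho hi).
  rewrite /=; apply/idP/idP => h; last by have := ltn_ord i; nia.
  by rewrite ltnNge; apply/negP => h'; have := ltn_ord i; nia.
have ltRL x (i : 'I_d) : (rho' (inr i) < rho' (inl x)) = (rho hi <= rho x).
  rewrite /=; apply/idP/idP => h; last by have := ltn_ord i; nia.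
  by rewrite leqNgt; apply/negP => h'; have := ltn_ord i; nia.
have ltR (i j : 'I_d) : (rho' (inr i) < rho' (inr j)) = (i < j).
  by rewrite /= ltn_add2l.
set K := clique_join H lo hi t.
have simu (u : 'I_d) : simplicial K (inr u).
  move=> [x|x] [y|y] //=.
  move=> /orP[]/eqP -> /orP[]/eqP -> //; by rewrite ?eqxx // edge_sym.
have nS x y i a : spanned H rho x y a -> a != f i.
  by apply: contraTneq => ->; apply: fS.
have betw x : rho lo < rho x -> ~~ (rho x < rho hi).
  move=> lx; apply/negP => xh.
  have [|_ Hxh _] := rhoS lo hi x; first by rewrite /spanned Hlh lx xh.
  by move: lx; rewrite (fN' x) // ltnn.
have spK a b k : spanned K rho' a b k -> [/\ simplicial K k, K k b, K k a &
    forall i, k <> inl (f i)].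
  case: a b k => [a|a] [b|b] [k|k] /and3P[]; rewrite ?ltL ?ltLR ?ltRL ?ltR.
  - move=> /= Hab ak kb; have sp : spanned H rho a b k by rewrite /spanned Hab ak.
    have [simk Hkb /(_ isT) Hka] := rhoS _ _ _ sp; split=> //.
      have [kl kh] : k != lo /\ k != hi by split; apply: nS sp.
      move=> [x|x] [y|y] //=; rewrite ?(negbTE kl) ?(negbTE kh) //.
      exact: simk.
    by move=> i [kE]; move: (nS _ _ i _ sp); rewrite kE eqxx.
  - move=> /= Hab ah hb; have bh : b = hi.
      apply: rho_inj; apply/eqP; rewrite eqn_leq hb andbT leqNgt.
      by apply: contra (fS w2 a b) => lt_hb; rewrite /spanned Hab ah.
    have al : a = lo by apply: fN' => //; move: Hab; rewrite bh.
    by split=> //=; rewrite ?bh ?al eqxx ?orbT.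
  - move=> /= /orP[] /eqP -> ak kh; first by move: (betw k ak); rewrite kh.
    by move: (ltn_trans ak kh); rewrite ltnn.
  - by move=> /= aE _ kb; split=> //=; apply: contraTneq kb => ->; rewrite ltnn.
  - move=> /= /orP[]/eqP -> hk kb; last by move: kb; rewrite ltnNge hk.
    by move: (leq_ltn_trans hk kb); rewrite ltnNge ltnW.
  - by move=> /= bE ak _; split=> //=; apply: contraTneq ak => ->; rewrite ltnn.
  - by move=> /= _ hk; rewrite ltnNge hk.
  - move=> /= _ ak kb; split=> //=; first by apply: contraTneq kb => ->; rewrite ltnn.
    by apply: contraTneq ak => ->; rewrite ltnn.
exists rho'; split=> [|i j|i a b|i j|i j ij].
- split=> [x y e|a b k /spK[]|//]; last by split.
  have : ~~ (rho' x < rho' y) && ~~ (rho' y < rho' x) by rewrite e ltnn.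
  case: x y {e} => [x|x] [y|y]; rewrite ?ltL ?ltLR ?ltRL ?ltR -?leqNgt => xy.
  - by congr inl; apply: rho_inj; apply/eqP; rewrite eqn_leq andbC.
  - by move: xy; rewrite -ltnNge => /andP[]; rewrite leqNgt => /negP.
  - by move: xy; rewrite -ltnNge => /andP[]; rewrite ltnNge => /negP.
  - by congr inr; apply: val_inj; apply/eqP; rewrite eqn_leq andbC.
- by rewrite ltL; apply: rhof.
- by apply/negP => /spK[_ _ _ /(_ i)].
- exact: fE.
rewrite inE negb_or => /andP[ijw ijused] [x|x].
  by rewrite ltL => /= Hx lt_x; congr inl; apply: (fN i j).
rewrite ltRL => /= /orP[]/eqP jE; first by rewrite jE leqNgt lohi.
have j2 : j = w2 by apply: f_inj.
have i1 : i = w1 by apply: val_inj => /=; apply/eqP; rewrite -eqSS ij w12E j2.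
by rewrite i1 j2 eqxx in ijw.
Qed.

Lemma whiskered_block_order (T : finType) (H : sgraph T) rho
    (U : finType) (H' : sgraph U) (g : T -> U) :
  block_order H predT rho -> whiskered H H' g ->
  (forall v x y v' x' y', ~~ net_at H' v x y v' x' y') ->
  exists D rho', block_order H' D rho' /\ forall x, D (g x).
Proof.
move=> rhoH; elim=> {U H' g} [|U H' g v _ IH] nf; first by exists predT, rho.
have [|D [rho' [rhoH' Dg]]] := IH.
  by move=> v0 x y v' x' y'; apply: (nf (Some v0) (Some x) (Some y) (Some v') (Some x') (Some y')).
have [rho'' rhoH''] := add_whisker_block_order (Dg v) rhoH' nf.
by exists (whisker_base D), rho''.
Qed.

Lemma net_free_caterpillar_order (V : finType) (G : sgraph V) :
  generalized_caterpillar G -> net_free G ->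
  exists2 rho : V -> nat, injective rho &
    forall a b k, spanned G rho a b k -> simplicial G k /\ G k b.
Proof.
move=> [r [T [H [f [used [U [H' [g [cH wH' [h bij_h hE]]]]]]]]]] nf.
have [rho [rhoH _ _ _ _]] := clique_joined_block_order cH.
have [|D [rho' [[rho_inj rhoS _] _]]] := whiskered_block_order rhoH wH'.
  move=> v x y v' x' y'; rewrite /net_at -!hE; exact: net_free_at nf.
have [h' hK h'K] := bij_h.
exists (rho' \o h'); first exact: inj_comp rho_inj (can_inj h'K).
have GE x y : G x y = H' (h' x) (h' y) by rewrite -hE !h'K.
move=> a b k; rewrite /spanned GE -/(spanned H' rho' _ _ _) => /rhoS[simk Hkb _].
split; last by rewrite GE.
by move=> x y; rewrite !GE => Hx Hy xy; apply: simk; rewrite // (inj_eq (can_inj h'K)).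
Qed.

End GraphOrders.

(** * Powers of ideals and Frobenius *)

Section IdealPowers.
Variable R : comNzRingType.
Implicit Types (I J P : R -> Prop).

(** For [P] prime, the contraction of the localization of the ideal [I] at [P], without the local
    ring. This is the form in which [symbolic_powerE] tests symbolic powers. *)
Definition local_at P I : R -> Prop := fun x => exists2 s, ~ P s & I (s * x).

Lemma local_at_ideal P I : prime_ideal P -> ideal I -> ideal (local_at P I).
Proof.
move=> [_ P1 PM] iI; split=> [|x y [s ns hs] [t nt ht]|c x [s ns hs]].
- by exists 1; rewrite ?mulr0 //; apply: (ideal0 iI).
- exists (s * t); first by move=> /PM[].
  rewrite mulrDr; apply: (idealD iI); last by rewrite -mulrA; apply: (idealM iI).
  by rewrite mulrAC; apply: (idealMr _ iI).
- by exists s; rewrite // mulrCA; apply: (idealM iI).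
Qed.

Lemma local_at_sub P I x : prime_ideal P -> I x -> local_at P I x.
Proof. by move=> [_ P1 _] Ix; exists 1; rewrite ?mul1r. Qed.

Lemma local_at_mul P I s x : prime_ideal P -> ~ P s -> local_at P I (s * x) ->
  local_at P I x.
Proof.
move=> [_ _ PM] nPs [t nPt ht]; exists (t * s); first by move=> /PM[].
by rewrite -mulrA.
Qed.

Lemma local_at_exp P I J m : prime_ideal P ->
  (forall x, J x -> local_at P I x) ->
  forall x, ideal_exp J m x -> local_at P (ideal_exp I m) x.
Proof.
move=> pP JI; elim: m => [|m IH] x Jx; first exact: local_at_sub.
have iL := local_at_ideal pP (ideal_expP I m.+1).
apply: Jx => // _ [u [v [/JI[s ns Iu] /IH[t nt Iv] ->]]].
have [_ _ PM] := pP; exists (s * t); first by move=> /PM[].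
by rewrite mulrACA; apply: ideal_gen_sub; exists (s * u), (t * v).
Qed.

Lemma ideal_exp_le I m m' x : (m <= m')%N -> ideal_exp I m' x -> ideal_exp I m x.
Proof.
move=> /subnK <-; elim: (m' - m)%N x => // d IH x; rewrite addSn /=.
apply; first exact: ideal_expP.
by move=> _ [u [v [_ /IH hv ->]]]; apply: (idealM (ideal_expP _ _)).
Qed.

Lemma ideal_exp_prod I (T : eqType) (r : seq T) (A : pred T) (F : T -> R) (b : T -> nat) :
  (forall i, A i -> ideal_exp I (b i) (F i)) ->
  ideal_exp I (\sum_(i <- r | A i) b i) (\prod_(i <- r | A i) F i).
Proof.
move=> hF; elim/big_rec2: _ => // i x n Ai IH.
by apply: ideal_exp_mul => //; apply: hF.
Qed.

Lemma ideal_exp_pow_exp I a m x : ideal_exp I a x -> ideal_exp I (a * m) (x ^+ m).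
Proof.
move=> Ix; elim: m => [|m IH]; first by rewrite muln0.
by rewrite mulnS exprS; apply: ideal_exp_mul.
Qed.

Section Pigeonhole.
Variables (h : nat) (z : 'I_h -> R).
Local Notation I := (ideal_gen (fun y => exists i, y = z i)).

Lemma ideal_exp_monomials M x : ideal_exp I M x ->
  ideal_gen (fun y => exists2 a : 'I_h -> nat, (\sum_i a i)%N = M &
    y = \prod_i z i ^+ a i) x.
Proof.
elim: M x => [|M IH] x.
  move=> _; rewrite -(mulr1 x); apply: (idealM (ideal_genP _)).
  apply: ideal_gen_sub; exists (fun=> 0%N); first by rewrite big1.
  by rewrite big1.
set G := ideal_gen (fun y => exists2 a : 'I_h -> nat, (\sum_i a i)%N = M.+1 & _).
have iG : ideal G by apply: ideal_genP.
have cl w : ideal (fun u => G (u * w)).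
  split=> [|a b|a b]; first by rewrite mul0r; apply: (ideal0 iG).
  - by rewrite mulrDl; apply: (idealD iG).
  - by rewrite -mulrA; apply: (idealM iG).
apply=> // _ [u [v [Iu /IH Iv ->]]].
apply: (Iu (fun u => G (u * v)) (cl v)) => _ [i ->].
rewrite mulrC; apply: (Iv (fun v => G (v * z i)) (cl (z i))) => _ [a aM ->].
apply: ideal_gen_sub; exists (fun j => (a j + (j == i))%N).
  rewrite big_split /= aM (bigD1 i) //= eqxx big1 ?addn0 ?addn1 //.
  by move=> j /negbTE ->.
under [RHS]eq_bigr do rewrite exprD.
rewrite big_split /= [X in _ = _ * X](bigD1 i) //= eqxx [X in _ = _ * (_ * X)]big1 ?mulr1 //.
by move=> j /negbTE ->.
Qed.

(** Divide the exponents of a monomial of degree [M] by [q]. The remainders add up to at most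
    [h * q.-1], so the quotients add up to at least [m], and the [q]-th power of the monomial formed
    by them is a factor. *)
Lemma ideal_exp_pigeonhole q m M x : (0 < q)%N ->
  (h * q.-1 + q * m < M + q)%N -> ideal_exp I M x ->
  ideal_gen (fun y => exists2 u, ideal_exp I m u & y = u ^+ q) x.
Proof.
move=> q0 lt_M /ideal_exp_monomials; apply; first exact: ideal_genP.
move=> _ [a aM ->].
have aE i : a i = (a i %/ q * q + a i %% q)%N by apply: divn_eq.
under eq_bigr => i _ do rewrite aE exprD exprM.
rewrite big_split /= prodrXl; apply: (idealMr _ (ideal_genP _)).
apply: ideal_gen_sub; exists (\prod_i z i ^+ (a i %/ q)) => //.
apply: (@ideal_exp_le _ _ (\sum_i a i %/ q)).
  have : (\sum_i a i %% q <= h * q.-1)%N.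
    rewrite -[h in leqRHS]card_ord -sum_nat_const; apply: leq_sum => i _.
    by rewrite -ltnS prednK // ltn_mod.
  have : (\sum_i a i = (\sum_i a i %/ q) * q + \sum_i a i %% q)%N.
    by rewrite big_distrl -big_split; apply: eq_bigr => i _; apply: aE.
  rewrite aM => ME rem_le; rewrite ME in lt_M; nia.
apply: ideal_exp_prod => i _; apply: ideal_exp_pow.
by apply: ideal_gen_sub; exists i.
Qed.

End Pigeonhole.
End IdealPowers.

Section FrobeniusPower.
Variables (R : comNzRingType) (p : nat).
Hypothesis chR : p \in [pchar R].

Lemma pcharf_expB e : {morph (fun x : R => x ^+ (p ^ e)) : x y / x - y}.
Proof.
elim: e => [|e IH] x y; first by rewrite expn0 !expr1.
by rewrite expnSr !exprM IH -!(pFrobenius_autE chR) rmorphB.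
Qed.

Lemma pcharf_expD e : {morph (fun x : R => x ^+ (p ^ e)) : x y / x + y}.
Proof.
elim: e => [|e IH] x y; first by rewrite expn0 !expr1.
by rewrite expnSr !exprM IH -!(pFrobenius_autE chR) rmorphD.
Qed.

Lemma pcharf_exp_gt0 e : (0 < p ^ e)%N.
Proof. by rewrite expn_gt0 prime_gt0 // (pcharf_prime chR). Qed.

Lemma pcharf_exp_sum e (T : Type) (r : seq T) (A : pred T) (F : T -> R) :
  (\sum_(i <- r | A i) F i) ^+ (p ^ e) = \sum_(i <- r | A i) F i ^+ (p ^ e).
Proof.
by apply: (big_morph _ (pcharf_expD e)); rewrite expr0n eqn0Ngt pcharf_exp_gt0.
Qed.

End FrobeniusPower.

(** * Functionals on [k] linear for the inverse Frobenius *)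

Section RootFunctional.
Variables (k : fieldType) (p e : nat).
Hypothesis chk : p \in [pchar k].
Local Notation q := (p ^ e)%N.

(* Among the families which together with [u] span [k] over [k ^ q], a smallest
   one makes the coefficient of [u] unique. *)
Lemma root_functional (s : seq k) (u : k) : u != 0 ->
  (forall x, exists a : 'I_(size s) -> k, x = \sum_i a i ^+ q * s`_i) ->
  exists l : k -> k, [/\ l u = 1, {morph l : x y / x + y} &
    forall a b, l (a ^+ q * b) = a * l b].
Proof.
move=> u0 hs.
pose D N := `[< exists t : 'I_N -> k, forall x, exists b (a : 'I_N -> k),
  x = b ^+ q * u + \sum_i a i ^+ q * t i >].
have exD : exists N, D N.
  exists (size s); apply/asboolP; exists (fun i => s`_i) => x.
  have [a ->] := hs x; exists 0, a.
  by rewrite expr0n eqn0Ngt (pcharf_exp_gt0 chk) mul0r add0r.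
case: (ex_minnP exD) => N /asboolP[t ht] minN.
have q0 := pcharf_exp_gt0 chk e.
have qx0 : (0 : k) ^+ q = 0 by rewrite expr0n eqn0Ngt q0.
have uniq0 b (a : 'I_N -> k) : b ^+ q * u + \sum_i a i ^+ q * t i = 0 -> b = 0.
  move=> h0; apply: contrapT => /eqP b0.
  (* As [b ^+ q * u] is nonzero, some [t j] occurs in the relation; solving for it leaves a smaller
     family. *)
  have [j aj] : exists j, a j != 0.
    apply: contrapT => /forallNP h; move/eqP: h0; rewrite big1.
      by rewrite addr0 mulf_eq0 expf_eq0 (negbTE b0) andbF (negbTE u0).
    by move=> i _; move: (h i) => /negP/negPn/eqP ->; rewrite qx0 mul0r.
  case: N => [|N] in t ht minN a h0 j aj *; first by case: {aj} j.
  suff /minN : D N by rewrite ltnn.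
  apply/asboolP; exists (fun i => t (lift j i)) => x.
  have [b' [a' ->]] := ht x.
  have tj : t j = (- b / a j) ^+ q * u + \sum_i (- a (lift j i) / a j) ^+ q * t (lift j i).
    have ajq : a j ^+ q != 0 by rewrite expf_neq0.
    have Nq c : (- c / a j) ^+ q = - (c ^+ q / a j ^+ q).
      by rewrite mulNr -sub0r pcharf_expB // qx0 sub0r exprMn exprVn.
    rewrite Nq; under eq_bigr => i _ do rewrite Nq.
    apply: (mulfI ajq); move/eqP: h0; rewrite (bigD1_ord j) //= addrCA addr_eq0 => /eqP ->.
    rewrite mulrDr opprD mulNr mulrN mulrA [_ * (_ / _)]mulrC divfK //; congr (_ + _).
    rewrite mulr_sumr -sumrN; apply: eq_bigr => i _.
    by rewrite mulNr mulrN mulrA [_ * (_ / _)]mulrC divfK.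
  exists (b' + a' j * (- b / a j)), (fun i => a' (lift j i) + a' j * (- a (lift j i) / a j)).
  rewrite (bigD1_ord j) //= {1}tj pcharf_expD // [(a' j * _) ^+ q]exprMn mulrDl
    -!addrA; congr (_ + _).
  rewrite mulrDr mulrA -!addrA; congr (_ + _).
  rewrite mulr_sumr -big_split; apply: eq_bigr => i _ /=.
  by rewrite pcharf_expD // [in RHS]exprMn mulrDl addrC mulrA.
have uniq b b' (a a' : 'I_N -> k) : b ^+ q * u + \sum_i a i ^+ q * t i =
    b' ^+ q * u + \sum_i a' i ^+ q * t i -> b = b'.
  move=> /eqP; rewrite -subr_eq0 opprD addrACA -mulrBl -pcharf_expB // -sumrB => /eqP h.
  apply/eqP; rewrite -subr_eq0; apply/eqP; apply: (@uniq0 _ (fun i => a i - a' i)).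
  by rewrite -[RHS]h; congr (_ + _); apply: eq_bigr => i _; rewrite pcharf_expB // mulrBl.
have /choice[l hl] := ht; have /choice[a ha] := hl.
exists l; split=> [|x y|c x].
- apply: (@uniq _ _ (a u) (fun=> 0)); rewrite -ha expr1n mul1r big1 ?addr0 //.
  by move=> i _; rewrite qx0 mul0r.
- apply: (@uniq _ _ (a (x + y)) (fun i => a x i + a y i)); rewrite -ha pcharf_expD // mulrDl.
  rewrite [in LHS](ha x) [in LHS](ha y) addrACA; congr (_ + _).
  by rewrite -big_split; apply: eq_bigr => i _; rewrite pcharf_expD // mulrDl.
- apply: (@uniq _ _ (a (c ^+ q * x)) (fun i => c * a x i)); rewrite -ha.
  rewrite [in LHS](ha x) mulrDr mulrA exprMn; congr (_ + _); rewrite mulr_sumr.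
  by apply: eq_bigr => i _; rewrite mulrA exprMn.
Qed.

End RootFunctional.

(** * The trace on a polynomial ring *)

Section Trace.
Variables (k : fieldType) (d : nat).
Local Notation S := {mpoly k[d]}.
Implicit Types (m : 'X_{1..d}) (q : nat) (l : k -> k).

Definition trace_mnm q m : 'X_{1..d} := [multinom (q * m i + q.-1)%N | i < d].

(* For [q = p ^ e] and [l] a [p ^ (- e)]-linear map on [k], this sends
   [c X ^ (q m + (q - 1, .., q - 1))] to [l c X ^ m] and the other monomials to
   [0]. *)
Definition mtrace q l (s : S) : S :=
  \sum_(m : 'X_{1..d < msize s}) l s@_(trace_mnm q m) *: 'X_[m].

Lemma mcoeff_trace q l s m : (0 < q)%N -> l 0 = 0 ->
  (mtrace q l s)@_m = l s@_(trace_mnm q m).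
Proof.
move=> q0 l0; have [lt_m|le_m] := ltnP (mdeg m) (msize s).
  exact: (mcoeff_mpoly (fun m => l s@_(trace_mnm q m))).
(* The bound in the sum loses nothing: [trace_mnm q m] has at least the degree of [m]. *)
have -> : s@_(trace_mnm q m) = 0.
  apply: memN_msupp_eq0; apply/negP => /msize_mdeg_lt; apply/negP; rewrite -leqNgt.
  apply: (leq_trans le_m); rewrite !mdegE; apply: leq_sum => i _; rewrite mnmE.
  by case: q q0 => // q _; nia.
rewrite l0 raddf_sum big1 // => -[m' /= lt_m'] _; rewrite mcoeffZ mcoeffX.
by case: eqP lt_m' => [->|_ _]; rewrite ?mulr0 // ltnNge le_m.
Qed.

Lemma mcoeffMX_eq0 (s : S) m m' : ~~ (m <= m')%MM -> (s * 'X_[m])@_m' = 0.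
Proof.
move=> nle; apply: memN_msupp_eq0; rewrite (perm_mem (msuppMX s m)).
apply: contra nle => /mapP[m'' _ ->]; apply/mnm_lepP => i.
by rewrite mnmDE leq_addr.
Qed.

Section Frobenius.
Variables (p e : nat) (l : k -> k).
Hypothesis chk : p \in [pchar k].
Hypothesis lD : {morph l : x y / x + y}.
Local Notation q := (p ^ e)%N.
Hypothesis lZ : forall a b, l (a ^+ q * b) = a * l b.

Let q0 : (0 < q)%N. Proof. exact: pcharf_exp_gt0 chk e. Qed.
Let l0 : l 0 = 0.
Proof. by have /eqP := lD 0 0; rewrite addr0 -subr_eq0 opprD addNKr oppr_eq0 => /eqP. Qed.

Lemma mpoly_pchar : p \in [pchar S].
Proof.
move: chk; rewrite !inE => /andP[-> /eqP p0] /=; apply/eqP.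
by rewrite -mpolyC_nat p0 mpolyC0.
Qed.

Lemma mtraceD : {morph mtrace q l : x y / x + y}.
Proof. by move=> x y; apply/mpolyP => m; rewrite mcoeffD !mcoeff_trace // mcoeffD lD. Qed.

Lemma mtrace0 : mtrace q l 0 = 0.
Proof. by apply/mpolyP => m; rewrite mcoeff_trace // !mcoeff0 l0. Qed.

(** By additivity [r] may be taken to be a term. Its [q]-th power shifts exponents by [m *+ q], and
    this is also the shift from [trace_mnm q m''] to [trace_mnm q (m + m'')]. *)
Lemma mtrace_frobenius (r s : S) : mtrace q l (r ^+ q * s) = r * mtrace q l s.
Proof.
have chS := mpoly_pchar.
rewrite [r]mpolyE pcharf_exp_sum // !mulr_suml (big_morph _ mtraceD mtrace0).
apply: eq_bigr => m _; set c := r@_m.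
rewrite exprZn mpolyXn -!scalerAl (mulrC _ s) (mulrC 'X_[m]); apply/mpolyP => m'.
rewrite mcoeffZ mcoeff_trace // mcoeffZ lZ; congr (_ * _).
(* If [m] does not divide [m'], both sides vanish: a remainder [q - 1] cannot make up for a missing
   multiple of [q]. *)
have [le_mm'|nle] := boolP (m <= m')%MM; last first.
  rewrite !mcoeffMX_eq0 //; apply: contra nle => /mnm_lepP le; apply/mnm_lepP => i.
  by have := le i; rewrite mulmnE !mnmE; move: (q) q0 => [//|q'] _; nia.
rewrite -(submK le_mm') addmC mcoeffMX mcoeff_trace //.
set m'' := (m' - m)%MM; have -> : trace_mnm q (m + m'') = (m *+ q + trace_mnm q m'')%MM.
  by apply/mnmP => i; rewrite !(mnmE, mnmDE, mulmnE); lia.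
by rewrite mcoeffMX.
Qed.

End Frobenius.

(** In each variable the leading exponents [q.-1 - N] of the power of [f], [N - m0] of [mu] and [m0]
    of [c] add up to [q.-1]. The trace sees the leading coefficient in degree 0 and otherwise only
    coefficients beyond the leading monomial. *)
Lemma mtrace_lead (f c : S) (s : 'S_d) : f != 0 -> mlead (msym s f) = [multinom 1%N | i < d] ->
  c != 0 -> exists N (mu : S), forall q, (N < q)%N -> exists2 u : k, u != 0 &
    forall l, l 0 = 0 -> l u = 1 -> mtrace q l (f ^+ (q.-1 - N) * mu * c) = 1.
Proof.
move=> nz_f lf c0; set one := [multinom 1%N | i < d].
have onE a i : (one *+ a)%MM i = a by rewrite mulmnE mnmE mul1n.
have inj_s : injective (msym s : S -> S).
  by move=> x y /(congr1 (msym s^-1)); rewrite -!msymMm mulgV !msym1m.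
have f0 : msym s f != 0 by rewrite -(msym0 k s) (inj_eq inj_s).
have c0' : msym s c != 0 by rewrite -(msym0 k s) (inj_eq inj_s).
set m0 := mlead (msym s c); set N := mdeg m0.
have leN i : (m0 i <= N)%N by rewrite /N mdegE (bigD1 i) //= leq_addr.
exists N, ('X_[ [multinom (N - m0 (s i))%N | i < d] ]) => q lt_Nq.
set mu := 'X_[_]; set F := _ * mu * c.
have muE : msym s mu = 'X_[one *+ N - m0].
  rewrite msymX; congr 'X_[_]; apply/mnmP => i.
  by rewrite !(mnmE, mnmBE, onE) permKV.
have FE : msym s F = msym s f ^+ (q.-1 - N) * msym s mu * msym s c.
  by rewrite /F !msymM rmorphXn.
have fX0 := expf_neq0 (q.-1 - N) f0.
have mu0 : msym s mu != 0 by rewrite muE -mleadc_eq0 mleadXm mcoeffX eqxx oner_eq0.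
have leadF : mlead (msym s F) = (one *+ q.-1)%MM.
  rewrite FE !mleadM //; last exact: mulf_neq0.
  rewrite mleadX // muE lf mleadXm -/m0.
  apply/mnmP => i; rewrite !(mnmDE, mnmBE, onE); have := leN i; lia.
have sF m : F@_m = (msym s F)@_[multinom m ((s^-1)%g i) | i < d].
  by rewrite mcoeff_sym; congr _@__; apply/mnmP => i; rewrite !mnmE permK.
have F0 : msym s F != 0 by rewrite FE !mulf_neq0.
exists F@_(one *+ q.-1).
  rewrite sF; have -> : [multinom (one *+ q.-1)%MM ((s^-1)%g i) | i < d] = mlead (msym s F).
    by rewrite leadF; apply/mnmP => i; rewrite mnmE !onE.
  by rewrite mleadc_eq0.
move=> l l0 l1; have q0 : (0 < q)%N by case: (q) lt_Nq.
apply/mpolyP => m; rewrite mcoeff_trace // mcoeff1.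
have [->|m_neq0] := eqVneq m 0%MM.
  rewrite -l1; congr (l _@__); apply/mnmP => i.
  by rewrite onE !mnmE muln0.
rewrite sF mcoeff_gt_mlead // leadF.
set m' := [multinom _ | i < d].
have -> : m' = (one *+ q.-1 + [multinom (q * m ((s^-1)%g i))%N | i < d])%MM.
  by apply/mnmP => i; rewrite mnmDE onE !mnmE addnC.
rewrite -[X in (X < _)%O]addm0 ltmc_add2r lt_neqAle le0x andbT eq_sym.
apply: contra m_neq0 => /eqP/mnmP h; apply/eqP/mnmP => i.
have := h (s i); rewrite !mnmE permK => /eqP.
by rewrite muln_eq0 eqn0Ngt q0 => /eqP.
Qed.

End Trace.

(** * F-finite symbolic Rees algebras *)

Lemma poly_frobenius (A : comNzRingType) p e (F : {poly A}) : p \in [pchar A] ->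
  F ^+ (p ^ e) = \sum_(i < size F) F`_i ^+ (p ^ e) *: 'X^(p ^ e * i).
Proof.
move=> chA; have chP : p \in [pchar {poly A}] by rewrite (rmorph_pchar (@polyC A)).
rewrite -[F in LHS]coefK poly_def pcharf_exp_sum //; apply: eq_bigr => i _.
by rewrite exprZn -exprM mulnC.
Qed.

Lemma coef_frobenius (A : comNzRingType) p e (F : {poly A}) j : p \in [pchar A] ->
  (F ^+ (p ^ e))`_j = if (p ^ e %| j)%N then F`_(j %/ p ^ e) ^+ (p ^ e) else 0.
Proof.
move=> chA; have q0 := pcharf_exp_gt0 chA e; rewrite poly_frobenius // coef_sum.
under eq_bigr do rewrite coefZ coefXn.
case: ifP => [/dvdnP[i ->]|ndvd]; last first.
  rewrite big1 // => i _; case: eqP => [jE|_]; last by rewrite mulr0.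
  by rewrite jE dvdn_mulr in ndvd.
rewrite mulnK //; have [lt_i|le_i] := ltnP i (size F).
  rewrite (bigD1 (Ordinal lt_i)) //= mulnC eqxx mulr1 big1 ?addr0 // => i' ne.
  by rewrite eqn_pmul2l // -[X in X == _]/(val (Ordinal lt_i)) (inj_eq val_inj)
    eq_sym (negbTE ne) mulr0.
rewrite nth_default // expr0n eqn0Ngt q0 big1 // => i' _.
by rewrite mulnC eqn_pmul2l // gtn_eqF ?mulr0 // (leq_trans (ltn_ord i')).
Qed.

Section SymbolicReesStructure.
Variables (k : fieldType) (d : nat).
Local Notation S := {mpoly k[d]}.
Variable I : S -> Prop.
Local Notation R := (symbolic_rees I).

Lemma symbolic_power_noeth m : ideal (symbolic_power I m).
Proof. exact: symbolic_power_ideal (@noetherian_mpoly k d) I m. Qed.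

Lemma symbolic_reesP (r : R) m : symbolic_power I m (val r)`_m.
Proof. by case: r => F /= /asboolP. Qed.

Lemma symbolic_rees_monomial m x : symbolic_power I m x ->
  x *: 'X^m \in symbolic_rees_pred I.
Proof.
move=> Ix; apply/asboolP => j; rewrite coefZ coefXn; case: eqP => [->|_].
  by rewrite mulr1.
by rewrite mulr0; apply: (ideal0 (symbolic_power_noeth j)).
Qed.

Definition rees_component (r : R) m : R :=
  SymbolicRees (symbolic_rees_monomial (symbolic_reesP r m)).

Fact symbolic_const_subproof x : x%:P \in symbolic_rees_pred I.
Proof. by rewrite -alg_polyC; apply: (@symbolic_rees_monomial 0 x). Qed.

Definition symbolic_const (x : S) : R := SymbolicRees (symbolic_const_subproof x).

Fact symbolic_const_zmod_morphism : zmod_morphism symbolic_const.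
Proof. by move=> x y; apply: val_inj; rewrite /= polyCB. Qed.

Fact symbolic_const_monoid_morphism : monoid_morphism symbolic_const.
Proof. by split=> [|x y]; apply: val_inj; rewrite /= ?polyC1 ?polyCM. Qed.

HB.instance Definition _ := GRing.isZmodMorphism.Build S R symbolic_const
  symbolic_const_zmod_morphism.
HB.instance Definition _ := GRing.isMonoidMorphism.Build S R symbolic_const
  symbolic_const_monoid_morphism.

Lemma symbolic_rees_domain : GRing.integral_domain_axiom R.
Proof.
move=> x y /(congr1 val); rewrite rmorphM rmorph0 => /eqP.
by rewrite mulf_eq0 -!(rmorph0 (val : R -> {poly S})) !(inj_eq val_inj).
Qed.

Local Notation rval := (@symbolic_rees_val k d I).

Lemma rees_val_sum (T : Type) (r : seq T) (A : pred T) (F : T -> R) :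
  rval (\sum_(i <- r | A i) F i) = \sum_(i <- r | A i) rval (F i).
Proof. exact: (raddf_sum (val : R -> {poly S})). Qed.

Lemma rees_valD : {morph rval : x y / x + y}.
Proof. exact: (rmorphD (val : R -> {poly S})). Qed.

Lemma rees_valM : {morph rval : x y / x * y}.
Proof. exact: (rmorphM (val : R -> {poly S})). Qed.

Lemma rees_valX n : {morph rval : x / x ^+ n}.
Proof. exact: (rmorphXn (val : R -> {poly S})). Qed.

Lemma rees_componentE r m : rval (rees_component r m) = (rval r)`_m *: 'X^m.
Proof. by []. Qed.

Variables (p : nat) (chk : p \in [pchar k]).
Local Notation chR := (symbolic_rees_pchar I chk).

Lemma F_finite_sum e : F_finite chR -> exists s : seq R, forall x : R,
  exists a : 'I_(size s) -> R, x = \sum_i a i ^+ (p ^ e) * s`_i.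
Proof. by move=> /(_ e)[s hs]; exists s => x; have [a ha] := hs x; exists a. Qed.

(** The constant term of the component of degree 0 is a ring retraction onto [k], and carries
    generators to generators. *)
Lemma F_finite_field e : F_finite chR -> exists s : seq k, forall x : k,
  exists a : 'I_(size s) -> k, x = \sum_i a i ^+ (p ^ e) * s`_i.
Proof.
move=> /(F_finite_sum e)[s hs].
pose ev (r : R) : k := ((val r)`_0)@_0%MM.
have ev_coef0 (r r' : R) : ev (r * r') = ev r * ev r'.
  by rewrite /ev rmorphM /= coef0M rmorphM.
have evX (r : R) n : ev (r ^+ n) = ev r ^+ n.
  elim: n => [|n IH]; first by rewrite !expr0 /ev rmorph1 coef1 mcoeff1 eqxx.
  by rewrite !exprS ev_coef0 IH.
have ev0 : ev 0 = 0 by rewrite /ev rmorph0 coef0 mcoeff0.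
have evD : {morph ev : r r' / r + r'} by move=> r r'; rewrite /ev rmorphD coefD mcoeffD.
exists [seq ev r | r <- s] => x; have [a ha] := hs (symbolic_const x%:MP).
have sz := size_map ev s.
exists (fun i => ev (a (cast_ord sz i))).
have -> : x = ev (symbolic_const x%:MP) by rewrite /ev /= coefC mcoeffC eqxx mulr1.
rewrite ha (big_morph _ evD ev0) (reindex (cast_ord sz)) /=; last first.
  by exists (cast_ord (esym sz)) => i _; rewrite ?cast_ordK ?cast_ordKV.
apply: eq_bigr => i _; rewrite ev_coef0 evX; congr (_ * _).
by rewrite (nth_map 0) // -sz.
Qed.

Lemma symbolic_rees_noetherian : F_finite chR -> noetherian R.
Proof.
move=> /(F_finite_sum 1)[s hs]; rewrite expn1 in hs.
pose g := [seq rees_component r b | r <- s, b <- iota 0 (size (val r))].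
pose gens (i : 'I_(d + size g)) : R :=
  match split i with inl i => symbolic_const 'X_i | inr j => g`_j end.
pose Phi : {rmorphism {mpoly k[d + size g]} -> R} :=
  mmap (symbolic_const \o @mpolyC d k) gens.
apply: (noetherian_surj (f := Phi)); last exact: noetherian_mpoly.
pose A (r : R) := exists y, Phi y = r.
have AD r r' : A r -> A r' -> A (r + r').
  by move=> [y <-] [y' <-]; exists (y + y'); rewrite rmorphD.
have AM r r' : A r -> A r' -> A (r * r').
  by move=> [y <-] [y' <-]; exists (y * y'); rewrite rmorphM.
have A0 : A 0 by exists 0; rewrite rmorph0.
have A1 : A 1 by exists 1; rewrite rmorph1.
have AX r n : A r -> A (r ^+ n).
  by move=> Ar; elim: n => [|n IH]; rewrite ?expr0 // exprS; apply: (AM).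
have Agen i : A (gens i) by exists 'X_i; rewrite [LHS]mmapX mmap1U.
have Aconst x : A (symbolic_const x).
  elim/mpolyind: x => [|c m x mx c0 IH]; first by rewrite rmorph0.
  rewrite rmorphD; apply: (AD) => //; rewrite -mul_mpolyC rmorphM; apply: (AM).
    by exists c%:MP; rewrite [LHS]mmapC.
  rewrite mpolyXE_id rmorph_prod; apply: (big_ind A A1 AM) => i _.
  rewrite rmorphXn; apply: (AX); have := Agen (lshift _ i).
  by rewrite /gens (unsplitK (inl i)).
have Acomp r b : r \in s -> A (rees_component r b).
  move=> rs; have [lt_b|le_b] := ltnP b (size (val r)); last first.
    have -> : rees_component r b = 0; last by [].
    by apply: val_inj; rewrite /= nth_default ?scale0r.
  have gr : rees_component r b \in g by apply: allpairs_f_dep; rewrite ?mem_iota.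
  have lt_i : (index (rees_component r b) g < size g)%N by rewrite index_mem.
  have := Agen (rshift d (Ordinal lt_i)).
  by rewrite /gens (unsplitK (inr _)) /= nth_index.
have p2 : (1 < p)%N by rewrite prime_gt1 // (pcharf_prime chk).
have chS : p \in [pchar S] by apply: mpoly_pchar.
suff Am m r : A (rees_component r m).
  move=> r; have -> : r = \sum_(m < size (val r)) rees_component r m.
    by apply: val_inj; rewrite raddf_sum /= -poly_def coefK.
  exact: (big_ind A A0 AD).
elim/ltn_ind: m r => -[_ r|m IH r].
  rewrite (_ : rees_component r 0 = symbolic_const (val r)`_0) //.
  by apply: val_inj; rewrite /= expr0 alg_polyC.
have [a ha] := hs (rees_component r m.+1).
(* The power [a i ^+ p] lives in degrees divisible by [p]; its part of degree [j] is the [p]-th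
   power of the component of degree [j %/ p], which is less than [m.+1]. *)
have -> : rees_component r m.+1 = \sum_i \sum_(j < m.+2 | (p %| j)%N)
    rees_component (a i) (j %/ p) ^+ p * rees_component s`_i (m.+1 - j).
  have coefE : (rval r)`_m.+1 = (rval (rees_component r m.+1))`_m.+1.
    by rewrite rees_componentE coefZ coefXn eqxx mulr1.
  apply: val_inj; rewrite [LHS]rees_componentE coefE ha [RHS]rees_val_sum rees_val_sum.
  rewrite coef_sum scaler_suml; apply: eq_bigr => i _.
  rewrite rees_valM rees_valX coefM scaler_suml rees_val_sum [RHS]big_mkcond.
  apply: eq_bigr => j _; have := coef_frobenius 1 (rval (a i)) j chS.
  rewrite expn1 => ->.
  case: ifP => pj; last by rewrite mul0r scale0r.
  rewrite rees_valM rees_valX !rees_componentE exprZn -scalerAl -scalerAr scalerA.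
  by rewrite -exprM -exprD divnK // subnKC // -ltnS.
apply: (big_ind A A0 AD) => i _; apply: (big_ind A A0 AD) => j pj; apply: (AM).
  apply/AX/IH; rewrite ltnS; have := ltn_ord j; rewrite ltnS => lej.
  by rewrite -ltnS ltn_divLR; nia.
by apply: Acomp; rewrite mem_nth.
Qed.

End SymbolicReesStructure.

(** * The splitting criterion *)

Section Criterion.
Variables (k : fieldType) (d : nat).
Local Notation S := {mpoly k[d]}.
Variables (p : nat) (chk : p \in [pchar k]).

Section TraceOnFiltration.
Variables (e : nat) (l : k -> k).
Hypothesis lD : {morph l : x y / x + y}.
Local Notation q := (p ^ e)%N.
Hypothesis lZ : forall a b, l (a ^+ q * b) = a * l b.
Local Notation T := (@mtrace k d q l).

Lemma mtrace_bracket_power (J : S -> Prop) y : ideal J ->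
  ideal_gen (fun y => exists2 u, J u & y = u ^+ q) y -> J (T y).
Proof.
(* The property is stated for all multiples [r * y], so that it defines an ideal. *)
move=> iJ gy; rewrite -[y]mul1r; move: 1; apply: (gy (fun y => forall r, J (T (r * y)))) =>
  [|_ [u Ju ->] r].
  split=> [r|x x' Jx Jx' r|b x Jx r].
  - by rewrite mulr0 (mtrace0 d e chk lD); apply: (ideal0 iJ).
  - by rewrite mulrDr (mtraceD e chk lD); apply: (idealD iJ).
  - by rewrite mulrA; apply: Jx.
by rewrite mulrC (mtrace_frobenius chk lD lZ); apply: (idealMr _ iJ).
Qed.

(** Denominators are cleared by [v * u], which enters the trace as a [q]-th power. The argument then
    lies in the power of exponent [h * (q.-1 - N) + m] of the ideal of the [z j], hence in the
    Frobenius power of its [i]-th power, which the trace maps into the [i]-th power. *)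
Lemma local_at_trace (I P : S -> Prop) h (z : 'I_h -> S) (f mu x : S) N i m :
  prime_ideal P -> ideal I ->
  (forall j, local_at P I (z j)) ->
  (forall y, I y -> local_at P (ideal_gen (fun y => exists j, y = z j)) y) ->
  ideal_exp (ideal_gen (fun y => exists j, y = z j)) h f ->
  (h * q.-1 + q * i < h * (q.-1 - N) + m + q)%N ->
  local_at P (ideal_exp I m) x ->
  local_at P (ideal_exp I i) (T (f ^+ (q.-1 - N) * mu * x)).
Proof.
move=> pP iI zI IZ fZ lt_m [u nPu Iux]; set Z := ideal_gen _ in IZ fZ.
have q0 := pcharf_exp_gt0 chk e.
have ZI y : Z y -> local_at P I y.
  by apply=> [|_ [j ->]]; [apply: local_at_ideal|apply: zI].
have [v nPv Zvux] := local_at_exp pP IZ Iux.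
set g := f ^+ _ * mu * x.
have ZT : ideal_exp Z i (v * u * T g).
  rewrite -(mtrace_frobenius chk lD lZ); apply: (mtrace_bracket_power (ideal_expP _ _)).
  apply: (ideal_exp_pigeonhole q0 lt_m).
  have -> : (v * u) ^+ q * g = (v * u) ^+ q.-1 * mu * (f ^+ (q.-1 - N) * (v * (u * x))).
    by rewrite /g -[in LHS](prednK q0) exprS; ring.
  apply: (idealM (ideal_expP _ _)); apply: ideal_exp_mul => //.
  exact: ideal_exp_pow_exp.
have [_ _ PM] := pP; apply: (@local_at_mul _ _ _ (v * u)) => //; first by move=> /PM[].
exact: local_at_exp ZI _ ZT.
Qed.

End TraceOnFiltration.

Section PolySplitting.
Variables (T : S -> S) (q a : nat) (g : S).
Hypothesis T0 : T 0 = 0.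

Definition poly_splitting (F : {poly S}) : {poly S} :=
  \poly_(i < size F) T (g * F`_(q * i + a)).

Lemma coef_poly_splitting F i : (0 < q)%N ->
  (poly_splitting F)`_i = T (g * F`_(q * i + a)).
Proof.
move=> q0; rewrite coef_poly; case: ltnP => // le_i.
rewrite nth_default ?mulr0 //; apply: leq_trans le_i _; nia.
Qed.

End PolySplitting.

Lemma poly_splitting_frobenius (T : S -> S) e a g (r F : {poly S}) :
  (a < p ^ e)%N -> {morph T : x y / x + y} ->
  (forall x y, T (x ^+ (p ^ e) * y) = x * T y) ->
  poly_splitting T (p ^ e) a g (r ^+ (p ^ e) * F) =
    r * poly_splitting T (p ^ e) a g F.
Proof.
set q := (p ^ e)%N => lt_aq TD TZ; have q0 := pcharf_exp_gt0 chk e.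
have chS : p \in [pchar S] by apply: mpoly_pchar.
have T0 : T 0 = 0 by have := TZ 0 0; rewrite mulr0 mul0r.
have coefE := coef_poly_splitting (q := q) a g T0.
have sD : {morph poly_splitting T q a g : F G / F + G}.
  by move=> F1 F2; apply/polyP => i; rewrite coefD !coefE // coefD mulrDr TD.
have s0 : poly_splitting T q a g 0 = 0.
  by apply/polyP => i; rewrite coefE // !coef0 mulr0.
rewrite poly_frobenius // mulr_suml (big_morph _ sD s0) -[r in RHS]coefK poly_def mulr_suml.
apply: eq_bigr => j _; apply/polyP => i; rewrite -!scalerAl coefZ !coefE // coefZ.
rewrite mulrCA TZ !coefXnM coefE //; congr (_ * _).
(* As [a < q], the exponents [q * i + a] below [q * j] are those with [i < j]. *)
have -> : (q * i + a < q * j)%N = (i < j)%N.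
  apply/idP/idP => [h|lt_ij].
    by rewrite -(ltn_pmul2l q0); apply: leq_ltn_trans h; apply: leq_addr.
  by apply: (@leq_trans (q * i.+1)); [rewrite mulnS; lia|rewrite leq_pmul2l].
case: ltnP => le_ji; rewrite ?mulr0 //; congr (T (g * _`_ _)).
by rewrite mulnBr addnBAC // leq_pmul2l.
Qed.

Variable I : S -> Prop.
Hypothesis iI : ideal I.
Local Notation R := (symbolic_rees I).
Local Notation chR := (symbolic_rees_pchar I chk).
Local Notation rval := (@symbolic_rees_val k d I).

(** The bound [h0] serves all minimal primes at once, so that [e] can be chosen before [P]. *)
Theorem strongly_F_regular_symbolic_rees (f : S) (s : 'S_d) (h0 : nat) :
  f != 0 -> mlead (msym s f) = [multinom 1%N | i < d] ->
  (forall P, minimal_prime I P -> exists h (z : 'I_h -> S),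
    [/\ (h <= h0)%N, forall j, local_at P I (z j),
        forall y, I y -> local_at P (ideal_gen (fun y => exists j, y = z j)) y
      & ideal_exp (ideal_gen (fun y => exists j, y = z j)) h f]) ->
  F_finite chR -> strongly_F_regular chR.
Proof.
move=> f0 lf locP finR; split; [exact: symbolic_rees_domain|exact: symbolic_rees_noetherian finR|].
move=> c hc; have nS := @noetherian_mpoly k d.
have c0 : c != 0.
  apply/eqP; apply: (hc (fun x => x = 0)); split=> //; split=> [||x y xy0]; last first.
  - by have /orP[/eqP|/eqP] := symbolic_rees_domain xy0; [left|right].
  - by apply/eqP; apply: oner_neq0.
  by split=> [//|x y -> ->|b x ->]; rewrite ?addr0 ?mulr0.
have [a ca] : exists a, (rval c)`_a != 0.
  exists (size (rval c)).-1; rewrite -lead_coefE lead_coef_eq0.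
  by apply: contraNneq c0 => rc0; apply/eqP/val_inj; rewrite /= rc0.
have [N [mu hmu]] := mtrace_lead f0 lf ca.
(* Four bounds on [q]: [N] for the exponent of [f], [h0 * N] for the pigeonhole, [size (rval c)] to
   leave a single component of [c], and [a] for linearity. *)
have [e lt_e] : exists e, (N + h0 * N + size (rval c) + a < p ^ e)%N.
  exists (N + h0 * N + size (rval c) + a)%N; apply: ltn_expl.
  by rewrite prime_gt1 // (pcharf_prime chk).
set q := (p ^ e)%N in lt_e; have q0 := pcharf_exp_gt0 chk e.
have [u u0 hu] := hmu q ltac:(lia).
have [t ht] := F_finite_field e finR.
have [l [lu lD lZ]] := root_functional chk u0 ht.
set g := f ^+ (q.-1 - N) * mu in hu.
pose T := @mtrace k d q l.
have TD : {morph T : x y / x + y} := mtraceD e chk lD.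
have TZ : forall x y, T (x ^+ q * y) = x * T y := mtrace_frobenius chk lD lZ.
have l0 : l 0 = 0.
  by have := lD 0 0; rewrite addr0 => /eqP; rewrite -subr_eq0 opprD addNKr oppr_eq0 => /eqP.
have T0 : T 0 = 0 := mtrace0 d e chk lD.
have coefE := coef_poly_splitting a g T0.
pose psi := poly_splitting T q a g.
have psiD : {morph psi : F G / F + G}.
  by move=> F1 F2; apply/polyP => i; rewrite coefD !coefE // coefD mulrDr TD.
have psiR (r : R) : psi (rval r) \in symbolic_rees_pred I.
  apply/asboolP => -[//|i]; rewrite coefE //.
  apply/(symbolic_powerE nS) => P mP; have [h [z [le_h zI IZ fZ]]] := locP P mP.
  have [pP _ _] := mP.
  set m := (q * i.+1 + a)%N; have m0 : (0 < m)%N by rewrite /m; nia.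
  have lt_m : (h * q.-1 + q * i.+1 < h * (q.-1 - N) + m + q)%N by rewrite /m; nia.
  have Irm : local_at P (ideal_exp I m) (rval r)`_m.
    have := symbolic_reesP r m; rewrite -(prednK m0).
    by move=> /(symbolic_powerE nS); apply.
  exact: (local_at_trace lD lZ mu pP iI zI IZ fZ lt_m Irm).
pose phi (x : qroot chR e) : R^o := SymbolicRees (psiR x).
have phi_lin : linear phi.
  move=> r x y; apply: val_inj.
  change (psi (rval (r ^+ q * (x : R) + (y : R))) = rval (r * (phi x : R) + (phi y : R))).
  rewrite !rees_valD !rees_valM rees_valX psiD.
  have lt_aq : (a < p ^ e)%N by rewrite -/q; lia.
  by congr (_ + _); apply: (poly_splitting_frobenius g (rval r) (rval x) lt_aq TD TZ).
pose phiL : {linear qroot chR e -> R^o} :=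
  HB.pack phi (GRing.isLinear.Build R (qroot chR e) R^o _ phi phi_lin).
exists e, phiL => r; rewrite linearZ /=.
suff -> : phi (to_qroot chR e c) = 1 by rewrite /GRing.scale /= mulr1.
apply: val_inj; apply/polyP => i; rewrite /= coefE // coef1.
case: i => [|i]; first by rewrite muln0 add0n eqxx; exact: hu l0 lu.
have le_c : (size (rval c) <= q * i.+1 + a)%N by rewrite mulnS; lia.
by rewrite (nth_default _ le_c) mulr0.
Qed.

End Criterion.

(** * Minimal primes of a binomial edge ideal *)

Lemma mpoly_alg_ind (A : comNzRingType) d (Q : {mpoly A[d]} -> Prop) :
  (forall c, Q c%:MP) -> (forall i, Q 'X_i) ->
  (forall x y, Q x -> Q y -> Q (x + y)) -> (forall x y, Q x -> Q y -> Q (x * y)) ->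
  forall x, Q x.
Proof.
move=> QC QX QD QM; elim/mpolyind => [|c m x mx c0 Qx]; first by rewrite -mpolyC0.
apply: (QD) => //; rewrite -mul_mpolyC; apply: (QM) => //.
have Q1 : Q 1 by rewrite -mpolyC1.
rewrite mpolyXE_id; apply: (big_ind Q Q1 QM) => i _.
by elim: (m i) => [|b IH]; rewrite ?expr0 // exprS; apply: QM.
Qed.

Lemma ideal_congrM (A : comNzRingType) (I : A -> Prop) x x' y y' : ideal I ->
  I (x - x') -> I (y - y') -> I (x * y - x' * y').
Proof.
move=> iI Ix Iy; have -> : x * y - x' * y' = y * (x - x') + x' * (y - y') by ring.
exact: idealD iI _ _ (idealM iI y Ix) (idealM iI x' Iy).
Qed.

(** If [a] and [b] are the degrees of the first coefficients of [x] and [y] outside [P], then modulo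
    [P] the coefficient of [x * y] in degree [a + b] is the product of these two. *)
Lemma prime_ideal_poly (A : comNzRingType) (P : A -> Prop) :
  prime_ideal P -> prime_ideal (fun F : {poly A} => forall m, P F`_m).
Proof.
move=> [iP P1 PM]; split.
- split=> [m|x y Px Py m|a x Px m].
  + by rewrite coef0; apply: (ideal0 iP).
  + by rewrite coefD; apply: (idealD iP).
  + rewrite coefM; apply: (big_ind P); [exact: (ideal0 iP)|exact: (idealD iP)|] => i _.
    exact: (idealM iP).
- by move=> /(_ 0%N); rewrite coef1.
move=> x y Pxy; apply: contrapT => /not_orP[nx ny].
have first_out (F : {poly A}) : ~ (forall m, P F`_m) ->
    exists m, ~ P F`_m /\ forall j, (j < m)%N -> P F`_j.
  move=> /existsNP[m0 nm0].
  have ex : exists m, `[< ~ P F`_m >] by exists m0; apply/asboolP.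
  case: (ex_minnP ex) => m /asboolP nm minm; exists m; split=> // j lt_jm.
  by apply: contrapT => /asboolP/minm; rewrite leqNgt lt_jm.
have [a [na la]] := first_out x nx; have [b [nb lb]] := first_out y ny.
have lt_a : (a < (a + b).+1)%N by rewrite ltnS leq_addr.
have := Pxy (a + b)%N; rewrite coefM (bigD1 (Ordinal lt_a)) //= addKn => Ps.
have : P (x`_a * y`_b); last by case/PM.
rewrite -(addrK (\sum_(i < (a + b).+1 | i != Ordinal lt_a) x`_i * y`_(a + b - i)) (_ * _)).
apply: (idealB iP) => //; apply: (big_ind P); [exact: (ideal0 iP)|exact: (idealD iP)|].
move=> i ne; have [lt_i|] := ltnP i a; first by apply: (idealMr _ iP); apply: la.
rewrite leq_eqVlt => /predU1P[ai|lt_ai]; first by case/eqP: ne; apply: val_inj.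
by apply: (idealM iP); apply: lb; have := ltn_ord i; lia.
Qed.

Section BinomialEdgePrimes.
Variables (k : fieldType) (n : nat) (G : sgraph 'I_n).
Local Notation S := {mpoly k[n + n]}.
Local Notation J := (binomial_edge_ideal k G).
Local Notation x_ := (@xvar k n).
Local Notation y_ := (@yvar k n).

Definition minor (i j : 'I_n) : S := x_ i * y_ j - y_ i * x_ j.

Lemma minor_edge i j : G i j -> J (minor i j).
Proof. by move=> Gij; apply: ideal_gen_sub; exists i, j. Qed.

Lemma minorN i j : minor i j = - minor j i.
Proof. by rewrite /minor; ring. Qed.

Lemma binomial_edge_idealP : ideal J. Proof. exact: ideal_genP. Qed.

Section Prime.
Variable P : S -> Prop.
Hypothesis minP : minimal_prime J P.

Let pP : prime_ideal P. Proof. by case: minP. Qed.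
Let iP : ideal P. Proof. by case: pP. Qed.

Definition in_cut (i : 'I_n) : Prop := P (x_ i) /\ P (y_ i).

(* Otherwise the columns of the neighbours of [i] are proportional modulo [P];
   moving the column of [i] along their common direction [w] deforms [P] into a
   smaller prime containing [J]. *)
Lemma in_cut_nbrs i : in_cut i ->
  exists j l, [/\ G i j, G i l & ~ P (minor j l)].
Proof.
move=> [Pxi Pyi]; apply: contrapT => nex.
have par j l : G i j -> G i l -> P (minor j l).
  by move=> Gij Gil; apply: contrapT => nP; apply: nex; exists j, l.
(* The column of a neighbour outside the cut; if there is none, the columns of all neighbours vanish
   modulo [P] and [(1, 1)] will do. *)
have [w1 [w2 [wpar wout]]] : exists w1 w2,
    (forall b, G i b -> P (w1 * y_ b - w2 * x_ b)) /\ ~ (P w1 /\ P w2).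
  have [[j [Gij nTj]]|noj] := pselect (exists j, G i j /\ ~ in_cut j).
    by exists (x_ j), (y_ j); split=> // b Gib; apply: par.
  exists 1, 1; split=> [b Gib|[P1 _]]; last by case: pP.
  have [Pxb Pyb] : in_cut b by apply: contrapT => nTb; apply: noj; exists b.
  by rewrite !mul1r; apply: (idealB iP).
pose h (v : 'I_(n + n)) : {poly S} := match split v with
  | inl a => if a == i then 'X * w1%:P else (x_ a)%:P
  | inr a => if a == i then 'X * w2%:P else (y_ a)%:P end.
(* The column of [i] is replaced by ['X] times [w]; [P'] is the preimage of the extension of [P]. *)
pose theta : {rmorphism S -> {poly S}} := mmap (polyC \o @mpolyC _ k) h.
have thX v : theta 'X_v = h v by rewrite [LHS]mmapX mmap1U.
have thx a : theta (x_ a) = if a == i then 'X * w1%:P else (x_ a)%:P.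
  by rewrite thX /h (unsplitK (inl a)).
have thy a : theta (y_ a) = if a == i then 'X * w2%:P else (y_ a)%:P.
  by rewrite thX /h (unsplitK (inr a)).
pose P' F := forall m, P (theta F)`_m.
have pP' : prime_ideal P'.
  have [iQ Q1 QM] := prime_ideal_poly pP; split.
  - split=> [|x y|a x]; rewrite /P' ?rmorph0 ?rmorphD ?rmorphM.
    + exact: (ideal0 iQ).
    + exact: (idealD iQ).
    + exact: (idealM iQ).
  - by rewrite /P' rmorph1.
  - by move=> x y; rewrite /P' rmorphM; apply: QM.
have [iP' _ _] := pP'; have [_ subP minimP] := minP.
have JP' F : J F -> P' F.
  apply=> // _ [a [b [Gab ->]]].
  have Xc c : P c -> forall m, P ('X * c%:P)`_m.
    move=> Pc m; rewrite coefXM coefC; case: eqP => _; first exact: (ideal0 iP).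
    by case: eqP => _ //; apply: (ideal0 iP).
  have ab : a != b by apply: contraTneq Gab => ->; rewrite edge_irr.
  rewrite /P' rmorphB !rmorphM !thx !thy.
  have [ai|ai] := eqVneq a i; have [bi|bi] := eqVneq b i.
  - by rewrite ai bi eqxx in ab.
  - have -> : 'X * w1%:P * (y_ b)%:P - 'X * w2%:P * (x_ b)%:P =
        'X * (w1 * y_ b - w2 * x_ b)%:P by rewrite polyCB !polyCM; ring.
    by apply: Xc; apply: wpar; rewrite -ai.
  - have -> : (x_ a)%:P * ('X * w2%:P) - (y_ a)%:P * ('X * w1%:P) =
        'X * (- (w1 * y_ a - w2 * x_ a))%:P by rewrite polyCN polyCB !polyCM; ring.
    by apply: Xc; apply: (idealN iP); apply: wpar; rewrite edge_sym -bi.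
  - rewrite -!polyCM -polyCB => m; rewrite coefC; case: ifP => _; last exact: (ideal0 iP).
    by apply: subP; apply: minor_edge.
(* The constant term of [theta F] is congruent to [F] modulo [P], since [x_i] and [y_i] are in
   [P]. *)
have P'P F : P' F -> P F.
  move=> P'F; rewrite -[F](subrK (theta F)`_0); apply: (idealD iP); last exact: P'F.
  move: {P'F} F.
  have congr0 v : P v -> P (v - 0) by rewrite subr0.
  apply: mpoly_alg_ind => [c|v|x y Px Py|x y Px Py].
  - by rewrite [theta _]mmapC coefC eqxx subrr; apply: (ideal0 iP).
  - rewrite thX /h; case: splitP => a /= va.
      have -> : v = lshift n a by apply: val_inj.
      case: eqP => [->|_]; first by rewrite coefXM; apply: congr0.
      by rewrite coefC eqxx subrr; apply: (ideal0 iP).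
    have -> : v = rshift n a by apply: val_inj.
    case: eqP => [->|_]; first by rewrite coefXM; apply: congr0.
    by rewrite coefC eqxx subrr; apply: (ideal0 iP).
  - rewrite (rmorphD theta) coefD opprD addrACA; exact: (idealD iP Px Py).
  - by rewrite (rmorphM theta) coef0M; apply: (ideal_congrM iP Px Py).
(* By minimality [x_i] and [y_i] are in [P']; their images ['X * w1] and ['X * w2] force [w1] and
   [w2] into [P]. *)
have PP' := minimP P' pP' JP' P'P; apply: wout; split.
  by have := PP' _ Pxi 1%N; rewrite thx eqxx coefXM coefC.
by have := PP' _ Pyi 1%N; rewrite thy eqxx coefXM coefC.
Qed.

(** The minor of two neighbours of [i] lies in [J], hence in [P], against [in_cut_nbrs]. *)
Lemma simplicial_not_in_cut i : simplicial G i -> ~ in_cut i.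
Proof.
move=> si /in_cut_nbrs[j [l [Gij Gil]]]; apply; have [_ sub _] := minP.
have [->|jl] := eqVneq j l; last by apply: sub; apply: minor_edge; apply: si.
by rewrite /minor mulrC subrr; apply: (ideal0 iP).
Qed.

(** A 3 by 3 determinant on the columns [i], [j], [l] with a repeated row vanishes; its expansion
    shows that [minor j l] multiplies [x_i] and [y_i] into [J]. *)
Lemma in_cut_local i : in_cut i -> local_at P J (x_ i) /\ local_at P J (y_ i).
Proof.
move=> /in_cut_nbrs[j [l [Gij Gil nP]]]; split; exists (minor j l) => //.
  have -> : minor j l * x_ i = x_ j * minor i l - x_ l * minor i j.
    by rewrite /minor; ring.
  by apply: (idealB binomial_edge_idealP); apply: (idealM binomial_edge_idealP); apply: minor_edge.
have -> : minor j l * y_ i = y_ j * minor i l - y_ l * minor i j.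
  by rewrite /minor; ring.
by apply: (idealB binomial_edge_idealP); apply: (idealM binomial_edge_idealP); apply: minor_edge.
Qed.

(** The same identity, divided by whichever of [x_b] and [y_b] is outside [P]. *)
Lemma local_at_minor_trans (I : S -> Prop) a b c : ideal I -> ~ in_cut b ->
  local_at P I (minor a b) -> local_at P I (minor b c) -> local_at P I (minor a c).
Proof.
move=> iI nTb ab bc; have iL := local_at_ideal pP iI.
have [nx|/contrapT Px] := pselect (~ P (x_ b)).
  apply: (local_at_mul pP nx).
  have -> : x_ b * minor a c = x_ a * minor b c + x_ c * minor a b by rewrite /minor; ring.
  by apply: (idealD iL); apply: (idealM iL).
have ny : ~ P (y_ b) by move=> Py; apply: nTb.
apply: (local_at_mul pP ny).
have -> : y_ b * minor a c = y_ a * minor b c + y_ c * minor a b by rewrite /minor; ring.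
by apply: (idealD iL); apply: (idealM iL).
Qed.

End Prime.
End BinomialEdgePrimes.

(** * The spine polynomial *)

Section Spine.
Variables (k : fieldType) (n : nat).
Local Notation S := {mpoly k[n + n]}.

(* Position [0] carries the column [(1, 0)], position [i + 1] that of the
   vertex [s i], and position [n + 1] the column [(0, 1)]. *)
Definition spine_vertex (s : 'S_n) (j : nat) : option 'I_n :=
  if j is j'.+1 then omap s (insub j') else None.

Definition spine_x s j : S :=
  if spine_vertex s j is Some i then xvar k i else (j == 0%N)%:R.

Definition spine_y s j : S :=
  if spine_vertex s j is Some i then yvar k i else (j != 0%N)%:R.

(** For positive [n], the conventions at the ends make the first factor the [y] of the first vertex
    and the last factor the [x] of the last vertex. *)
Definition spine_factor s j : S :=
  spine_x s j * spine_y s j.+1 - spine_y s j * spine_x s j.+1.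

Definition spine_poly s : S := \prod_(j < n.+1) spine_factor s j.

Lemma spine_vertexS s (i : 'I_n) : spine_vertex s i.+1 = Some (s i).
Proof. by rewrite /= valK. Qed.

Lemma spine_vertex_last s : spine_vertex s n.+1 = None.
Proof. by rewrite /= insubF // ltnn. Qed.

Lemma big_spine_vertex (T : Type) (idx : T) (op : Monoid.law idx) s (F : option 'I_n -> T) :
  \big[op/idx]_(j < n.+1) F (spine_vertex s j) =
    op (F None) (\big[op/idx]_(i < n) F (Some (s i))).
Proof.
rewrite big_ord_recl; congr (op _ _); apply: eq_bigr => i _.
by rewrite lift0 spine_vertexS.
Qed.

Lemma big_spine_vertexS (T : Type) (idx : T) (op : Monoid.law idx) s (F : option 'I_n -> T) :
  \big[op/idx]_(j < n.+1) F (spine_vertex s j.+1) =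
    op (\big[op/idx]_(i < n) F (Some (s i))) (F None).
Proof.
rewrite big_ord_recr spine_vertex_last; congr (op _ _); apply: eq_bigr => i _.
by rewrite -spine_vertexS.
Qed.

Section Lead.
Variable s : 'S_n.

(** Renaming the [x] and the [y] simultaneously reduces the leading monomial to the case of the
    identity order. *)
Definition double_perm_fun (v : 'I_(n + n)) : 'I_(n + n) :=
  match split v with inl i => lshift n ((s^-1)%g i) | inr i => rshift n ((s^-1)%g i) end.

Lemma double_perm_fun_inj : injective double_perm_fun.
Proof.
have E u : double_perm_fun (unsplit u) = unsplit (match u with
    inl i => inl ((s^-1)%g i) | inr i => inr ((s^-1)%g i) end).
  by rewrite /double_perm_fun unsplitK; case: u.
move=> u v; rewrite -[u]splitK -[v]splitK !E => /(can_inj unsplitK).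
by case: (split u) (split v) => [i|i] [j|j] // [] /perm_inj ->.
Qed.

Definition double_perm : 'S_(n + n) := perm double_perm_fun_inj.

Lemma msym_spine_x j : msym double_perm (spine_x s j) = spine_x 1 j.
Proof.
rewrite /spine_x; case: j => [|j] /=; first by rewrite msym1.
case: insubP => [i _ _|_] /=; last by rewrite msym0.
by rewrite perm1 /msym mmapX mmap1U permE /double_perm_fun (unsplitK (inl _)) permK.
Qed.

Lemma msym_spine_y j : msym double_perm (spine_y s j) = spine_y 1 j.
Proof.
rewrite /spine_y; case: j => [|j] /=; first by rewrite msym0.
case: insubP => [i _ _|_] /=; last by rewrite msym1.
by rewrite perm1 /msym mmapX mmap1U permE /double_perm_fun (unsplitK (inr _)) permK.
Qed.

Lemma msym_spine_poly : msym double_perm (spine_poly s) = spine_poly 1.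
Proof.
rewrite rmorph_prod; apply: eq_bigr => j _.
by rewrite rmorphB !rmorphM /= !msym_spine_x !msym_spine_y.
Qed.

End Lead.

Definition mnm_x (o : option 'I_n) : 'X_{1..n + n} :=
  if o is Some i then U_(lshift n i)%MM else 0%MM.
Definition mnm_y (o : option 'I_n) : 'X_{1..n + n} :=
  if o is Some i then U_(rshift n i)%MM else 0%MM.

Lemma mleadB_monomial (m : 'X_{1..n + n}) (r : S) :
  r = 0 \/ (exists2 m', (m' < m)%O & r = 'X_[m']) -> mlead ('X_[m] - r) = m /\ 'X_[m] - r != 0.
Proof.
move=> rE; have X0 (m1 : 'X_{1..n + n}) : 'X_[m1] != 0 :> S.
  by rewrite -mleadc_eq0 mleadXm mcoeffX eqxx oner_eq0.
case: rE => [->|[m' lt_m ->]]; first by rewrite subr0 mleadXm X0.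
have E : mlead ('X_[m] - 'X_[m'] : S) = m by rewrite mleadDl ?mleadN !mleadXm.
split=> //; apply/eqP => /subr0_eq e; move: lt_m.
by rewrite -[m](@mleadXm _ k) e mleadXm ltxx.
Qed.

Lemma mlead_spine_factor (j : 'I_n.+1) :
  mlead (spine_factor 1 j) =
    (mnm_x (spine_vertex 1 j) + mnm_y (spine_vertex 1 j.+1))%MM /\
  spine_factor 1 j != 0.
Proof.
have xE : spine_x 1 j = 'X_[mnm_x (spine_vertex 1 j)].
  rewrite /spine_x; case: j => -[|j] /= lt_j; first by rewrite mpolyX0.
  by case: insubP => [i _ _|]; rewrite // -ltnS lt_j.
have yE : spine_y 1 j.+1 = 'X_[mnm_y (spine_vertex 1 j.+1)].
  by rewrite /spine_y; case: spine_vertex; rewrite ?mpolyX0.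
rewrite /spine_factor xE yE -mpolyXD.
apply: mleadB_monomial; rewrite /spine_x /spine_y.
case: j {xE yE} => -[|j] lt_j; first by left; rewrite mul0r.
have lt_jn : (j < n)%N by [].
have -> : spine_vertex 1 (Ordinal lt_j) = Some (Ordinal lt_jn).
  by rewrite -[RHS](congr1 Some (perm1 _)) -spine_vertexS.
have [lt_jn1|le_nj] := ltnP j.+1 n; last first.
  have -> : spine_vertex 1 (Ordinal lt_j).+1 = None by rewrite /= insubF // ltnNge le_nj.
  by left; rewrite mulr0.
have -> : spine_vertex 1 (Ordinal lt_j).+1 = Some (Ordinal lt_jn1).
  by rewrite -[RHS](congr1 Some (perm1 _)) -spine_vertexS.
right; exists (U_(rshift n (Ordinal lt_jn)) + U_(lshift n (Ordinal lt_jn1)))%MM;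
  last by rewrite mpolyXD.
(* Both monomials have degree 2, and the first variable in which they differ is the [x] of index
   [j]. *)
apply/ltmcP; first by rewrite !mdegD !mdeg1.
exists (lshift n (Ordinal lt_jn)) => [v lt_v|]; rewrite !mnmDE !mnm1E -!val_eqE /=; last by lia.
by move: lt_v => /=; lia.
Qed.

(** Each vertex contributes its [x] through the factor that starts at it and its [y] through the
    factor that ends at it. *)
Lemma mlead_spine_poly : mlead (spine_poly 1) = [multinom 1%N | i < n + n] /\
  spine_poly 1 != 0.
Proof.
have F0 (j : 'I_n.+1) : spine_factor 1 j != 0 by have [] := mlead_spine_factor j.
split; last by rewrite prodf_seq_neq0; apply/allP => j _; rewrite F0.
rewrite mlead_prod //; under eq_bigr => j _ do rewrite (proj1 (mlead_spine_factor j)).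
rewrite big_split (big_spine_vertex _ 1 mnm_x) (big_spine_vertexS _ 1 mnm_y) /=.
rewrite add0m addm0; apply/mnmP => v; rewrite mnmE mnmDE !mnm_sumE.
under eq_bigr => i _ do rewrite perm1 mnm1E.
under [X in (_ + X)%N]eq_bigr => i _ do rewrite perm1 mnm1E.
rewrite -[v]splitK; case: (split v) => a /=.
  rewrite (bigD1 a) //= eqxx !big1 // => i ne; first by rewrite eq_rlshift.
  by rewrite (inj_eq (@lshift_inj _ _)) (negbTE ne).
rewrite addnC (bigD1 a) //= eqxx !big1 // => i ne; first by rewrite eq_lrshift.
by rewrite (inj_eq (@rshift_inj _ _)) (negbTE ne).
Qed.

End Spine.

(** * Local generators of [J] at a minimal prime *)

Section LocalStructure.
Variables (k : fieldType) (n : nat) (G : sgraph 'I_n) (s : 'S_n).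
Local Notation S := {mpoly k[n + n]}.
Local Notation J := (binomial_edge_ideal k G).
Local Notation pos := (s^-1)%g.

Hypothesis sG : forall a b c, G a b -> (pos a < pos c)%N -> (pos c < pos b)%N ->
  simplicial G c /\ G c b.

Variable P : S -> Prop.
Hypothesis minP : minimal_prime J P.

Let pP : prime_ideal P. Proof. by case: minP. Qed.
Let iJ : ideal J := binomial_edge_idealP k G.

Let cut : {set 'I_n} := [set i | `[< in_cut P i >]].

Let cutP i : reflect (in_cut P i) (i \in cut).
Proof. by rewrite inE; apply: asboolP. Qed.

(** Linked vertices need not be adjacent: their minor only has to lie in [J] locally at [P]. *)
Let link (j : nat) : bool :=
  match spine_vertex s j, spine_vertex s j.+1 with
  | Some a, Some b => [&& a \notin cut, b \notin cut & `[< local_at P J (minor k a b) >]]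
  | _, _ => false
  end.

Let gens : seq S := [seq xvar k i | i in cut] ++ [seq yvar k i | i in cut] ++
  [seq spine_factor k s j | j : 'I_n.+1 in [pred j : 'I_n.+1 | link j]].

Let z (j : 'I_(size gens)) : S := gens`_j.
Let Z := ideal_gen (fun y => exists j, y = z j).

Let iZ : ideal Z. Proof. exact: ideal_genP. Qed.

Let Z_mem w : w \in gens -> Z w.
Proof.
move=> gw; have lt_w : (index w gens < size gens)%N by rewrite index_mem.
by apply: ideal_gen_sub; exists (Ordinal lt_w); rewrite /z /= nth_index.
Qed.

Let Z_x i : i \in cut -> Z (xvar k i).
Proof. by move=> Ti; apply: Z_mem; rewrite mem_cat image_f. Qed.

Let Z_y i : i \in cut -> Z (yvar k i).
Proof. by move=> Ti; apply: Z_mem; rewrite !mem_cat [X in _ || (X || _)]image_f ?orbT. Qed.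

Let Z_link (j : 'I_n.+1) : link j -> Z (spine_factor k s j).
Proof. by move=> lj; apply: Z_mem; rewrite !mem_cat [X in _ || (_ || X)]image_f ?orbT. Qed.

Lemma spine_factorS (j : 'I_n.+1) a b : spine_vertex s j = Some a ->
  spine_vertex s j.+1 = Some b -> spine_factor k s j = minor k a b.
Proof. by rewrite /spine_factor /spine_x /spine_y => -> ->. Qed.

Let Z_local y : Z y -> local_at P J y.
Proof.
apply=> [|_ [j ->]]; first exact: local_at_ideal.
have : z j \in gens by apply: mem_nth.
rewrite !mem_cat => /or3P[] /imageP[i].
- by move=> /cutP/(in_cut_local minP)[Jx _] ->.
- by move=> /cutP/(in_cut_local minP)[_ Jy] ->.
move=> + -> => /=; rewrite inE /link.
case Ea: (spine_vertex s i) => [a|//]; case Eb: (spine_vertex s i.+1) => [b|//].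
by move=> /and3P[_ _ /asboolP]; rewrite (spine_factorS Ea Eb).
Qed.

Let local_link c b : G c b \/ c = b -> b \notin cut ->
  forall c', G c' b \/ c' = b -> local_at P J (minor k c c').
Proof.
have minor_nbr a a' : G a a' \/ a = a' -> local_at P J (minor k a a').
  case=> [Gaa'|->]; first by apply: local_at_sub pP _; apply: minor_edge.
  by rewrite /minor mulrC subrr; apply: (ideal0 (local_at_ideal pP iJ)).
move=> cb nTb c' c'b; apply: (local_at_minor_trans minP (b := b) iJ).
- by move=> /cutP Tb; rewrite Tb in nTb.
- exact: minor_nbr.
- by apply: minor_nbr; case: c'b => [|->]; [left; rewrite edge_sym|right].
Qed.

(** If no end of the edge [a], [b] is in the cut, the vertices between are simplicial, hence outside
    the cut, and adjacent to [b]. Through [b] any two of them have their minor locally in [J], so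
    consecutive ones are linked, and the minors of the links combine to [minor k a b]. *)
Let J_local y : J y -> local_at P Z y.
Proof.
have iL := local_at_ideal pP iZ.
apply=> // _ [a [b [Gab ->]]]; rewrite -/(minor k a b).
wlog ab : a b Gab / (pos a < pos b)%N => [hw|].
  have /orP[] : (pos a < pos b)%N || (pos b < pos a)%N.
  - rewrite -neq_ltn; apply: contraTneq Gab => /val_inj/perm_inj ->.
    by rewrite edge_irr.
  - exact: hw.
  - by rewrite minorN => ba; apply: (idealN iL); apply: hw; rewrite // edge_sym.
have [Ta|nTa] := boolP (a \in cut).
  apply: local_at_sub pP _; apply: (idealB iZ); apply: (idealMr _ iZ); [exact: Z_x|exact: Z_y].
have [Tb|nTb] := boolP (b \in cut).
  apply: local_at_sub pP _; apply: (idealB iZ); apply: (idealM iZ); [exact: Z_y|exact: Z_x].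
have between c : (pos a <= pos c <= pos b)%N -> c \notin cut /\ (G c b \/ c = b).
  rewrite leq_eqVlt [(pos c <= _)%N]leq_eqVlt => /andP[].
  move=> /predU1P[/val_inj/perm_inj <- _|ac]; first by split=> //; left.
  move=> /predU1P[/val_inj/perm_inj ->|cb]; first by split=> //; right.
  have [simc Gcb] := sG Gab ac cb; split; last by left.
  by apply/negP => /cutP; apply: (simplicial_not_in_cut minP simc).
suff IH : forall m c, pos c = (pos a + m.+1)%N :> nat -> (pos c <= pos b)%N ->
    local_at P Z (minor k a c).
  by apply: (IH (pos b - (pos a).+1)%N) => //; lia.
have step c c' : (pos a <= pos c)%N -> pos c' = (pos c).+1 :> nat ->
    (pos c' <= pos b)%N -> Z (minor k c c').
  move=> ac cc' c'b; have [nTc cb] := between c ltac:(lia).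
  have [nTc' c'b'] := between c' ltac:(lia).
  have vc : spine_vertex s (pos c).+1 = Some c by rewrite spine_vertexS permKV.
  have vc' : spine_vertex s (pos c).+2 = Some c' by rewrite -cc' spine_vertexS permKV.
  have lt_j : ((pos c).+1 < n.+1)%N by rewrite ltnS.
  rewrite -(@spine_factorS (Ordinal lt_j) c c') //; apply: Z_link.
  by rewrite /link vc vc' nTc nTc'; apply/asboolP; apply: (local_link cb).
elim=> [|m IH] c posc le_cb.
  by apply: local_at_sub pP _; apply: step => //; lia.
have lt_c1 : ((pos c).-1 < n)%N by have := ltn_ord (pos c); lia.
pose c1 := s (Ordinal lt_c1); have posc1 : pos c1 = (pos c).-1 :> nat by rewrite permK.
have [nTc1 _] := between c1 ltac:(lia).
apply: (local_at_minor_trans minP (b := c1) iZ).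
- by move=> /cutP Tc1; rewrite Tc1 in nTc1.
- by apply: IH; lia.
- by apply: local_at_sub pP _; apply: step; lia.
Qed.

Let size_gens : size gens = (#|cut| + (#|cut| + #|[pred j : 'I_n.+1 | link j]|))%N.
Proof. by rewrite !size_cat !size_image. Qed.

(** Each generator is accounted for by a factor: a link by itself, the two variables of a cut vertex
    by the two factors in which it occurs. Both terms of a factor contain one variable of each end
    that is a vertex. *)
Let Z_spine : ideal_exp Z (size gens) (spine_poly k s).
Proof.
pose t (o : option 'I_n) : nat := if o is Some i then i \in cut : nat else 0%N.
have tE : (\sum_(i < n) t (Some (s i)))%N = #|cut|.
  rewrite -sum1_card [RHS]big_mkcond [RHS](reindex_inj (@perm_inj _ s)) /=.
  by apply: eq_bigr => i _; rewrite /t; case: (s i \in cut).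
have -> : size gens = (\sum_(j < n.+1)
    (t (spine_vertex s j) + (t (spine_vertex s j.+1) + link j)))%N.
  rewrite size_gens !big_split big_spine_vertex big_spine_vertexS /= tE add0n addn0.
  by congr (_ + (_ + _))%N; rewrite -sum1_card [LHS]big_mkcond;
    apply: eq_bigr => j _; rewrite inE; case: (link j).
have exp1 w : Z w -> ideal_exp Z 1 w.
  by move=> Zw; apply: ideal_gen_sub; exists w, 1; rewrite mulr1.
apply: ideal_exp_prod => j _.
have [lj|nlj] := boolP (link j).
  have -> : (t (spine_vertex s j) + (t (spine_vertex s j.+1) + 1) = 1)%N.
    move: lj; rewrite /link /t; case: (spine_vertex s j) => [a|//].
    by case: (spine_vertex s j.+1) => [b|//] /and3P[/negbTE-> /negbTE-> _].
  by apply: exp1; apply: Z_link.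
rewrite addn0; have expT i : ideal_exp Z (t (spine_vertex s i)) (spine_x k s i) /\
    ideal_exp Z (t (spine_vertex s i)) (spine_y k s i).
  rewrite /t /spine_x /spine_y; case: (spine_vertex s i) => [a|]; last by [].
  by have [Ta|nTa] := boolP (a \in cut); split=> //; apply: exp1; [apply: Z_x|apply: Z_y].
have [Xj Yj] := expT j; have [Xj1 Yj1] := expT j.+1.
by apply: (idealB (ideal_expP _ _)); apply: ideal_exp_mul.
Qed.

Lemma binomial_edge_local_structure : exists h (z : 'I_h -> S),
  [/\ (h <= n + (n + n.+1))%N, forall j, local_at P J (z j),
      forall y, J y -> local_at P (ideal_gen (fun y => exists j, y = z j)) y
    & ideal_exp (ideal_gen (fun y => exists j, y = z j)) h (spine_poly k s)].
Proof.
exists (size gens), z; split=> //; last first.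
  by move=> j; apply: Z_local; apply: ideal_gen_sub; exists j.
rewrite size_gens; apply: leq_add; first by rewrite -[n in leqRHS]card_ord max_card.
apply: leq_add; first by rewrite -[n in leqRHS]card_ord max_card.
by rewrite -[n.+1 in leqRHS]card_ord max_card.
Qed.

End LocalStructure.

(** * Vertex orders as permutations, and the conclusion *)

Lemma rank_perm n (rho : 'I_n -> nat) : injective rho ->
  exists s : 'S_n, forall a b, (s a < s b)%N = (rho a < rho b)%N.
Proof.
move=> rho_inj; pose below a := [set b | (rho b < rho a)%N].
have mono a b : (rho a < rho b)%N -> (#|below a| < #|below b|)%N.
  move=> ab; apply: proper_card; apply/properP; split.
    by apply/fintype.subsetP => c; rewrite !inE => /ltn_trans; apply.
  by exists a; rewrite !inE ?ltnn.
have lt_n a : (#|below a| < n)%N.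
  rewrite -[n in ltnRHS]card_ord -cardsT; apply: proper_card; apply/properP.
  by split; [apply: finset.subsetT|exists a; rewrite !inE ?ltnn].
have r_inj : injective (fun a => Ordinal (lt_n a)).
  move=> a b /(congr1 val) /= ab; apply: rho_inj; apply/eqP; rewrite eqn_leq.
  by apply/andP; split; rewrite leqNgt; apply/negP => /mono; rewrite ab ltnn.
exists (perm r_inj) => a b; rewrite !permE /=; apply/idP/idP; last exact: mono.
rewrite ltnNge [(rho a < _)%N]ltnNge; apply: contra; rewrite leq_eqVlt.
by move=> /predU1P[/rho_inj ->|/mono/ltnW].
Qed.

Theorem proposition3p13 (k : fieldType) (p : nat) (chk : p \in [pchar k]%R)
    (n : nat) (G : sgraph 'I_n)
    (caterpillarG : generalized_caterpillar G) (netfreeG : net_free G)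
    (F_finiteR :
       F_finite (symbolic_rees_pchar (binomial_edge_ideal k G) chk)) :
  strongly_F_regular (symbolic_rees_pchar (binomial_edge_ideal k G) chk).
Proof.
have [rho rho_inj rhoG] := net_free_caterpillar_order caterpillarG netfreeG.
have [s sE] := rank_perm rho_inj.
(* Here [s] sends vertices to positions, whereas the spine is indexed by the permutation from
   positions to vertices; hence the inverse. *)
have sG a b c : G a b -> (((s^-1)^-1)%g a < ((s^-1)^-1)%g c)%N ->
    (((s^-1)^-1)%g c < ((s^-1)^-1)%g b)%N ->
    simplicial G c /\ G c b.
  by rewrite invgK !sE => Gab ac cb; apply: (rhoG a b c); rewrite /spanned Gab ac cb.
have [lead_f nz_f] := mlead_spine_poly k n.
have f0 : spine_poly k (s^-1)%g != 0.
  by apply: contra_neq nz_f => f0; rewrite -(msym_spine_poly k (s^-1)%g) f0 msym0.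
have lf : mlead (msym (double_perm (s^-1)%g) (spine_poly k (s^-1)%g)) =
    [multinom 1%N | i < n + n] by rewrite msym_spine_poly.
apply: (strongly_F_regular_symbolic_rees (binomial_edge_idealP k G) f0 lf _ F_finiteR).
by move=> P minP; apply: (binomial_edge_local_structure sG minP).
Qed.
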